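(* Let $G=\mathrm{SL}(3,\mathbb{C})$. The ring of invariants $\mathbb{C}[G\times G]^G$ is generated as a $\mathbb{C}$-algebra by $$\mathrm{tr}(\mathbf{x}_1),\ \mathrm{tr}(\mathbf{x}_2),\ \mathrm{tr}(\mathbf{x}_1\mathbf{x}_2),\ \mathrm{tr}(\mathbf{x}_1\mathbf{x}_2^{-1}),\ \mathrm{tr}(\mathbf{x}_1^{-1}),\ \mathrm{tr}(\mathbf{x}_2^{-1}),\ \mathrm{tr}(\mathbf{x}_1^{-1}\mathbf{x}_2^{-1}),\ \mathrm{tr}(\mathbf{x}_1^{-1}\mathbf{x}_2),\ \mathrm{tr}(\mathbf{x}_1\mathbf{x}_2\mathbf{x}_1^{-1}\mathbf{x}_2^{-1}).$$
   Context: $G$ acts on $G\times G$ by simultaneous conjugation, and $\mathbb{C}[G\times G]^G$ is the ring of invariant regular functions. $\mathbf{x}_1,\mathbf{x}_2$ denote the two coordinate (generic) $3\times3$ matrices of determinant $1$, so that e.g. $\mathrm{tr}(\mathbf{x}_1\mathbf{x}_2^{-1})$ is the function $(A,B)\mapsto\mathrm{tr}(AB^{-1})$. *)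

(* Defs.v *)
From HB Require Import structures.
From mathcomp Require Import all_boot all_order all_algebra.
From mathcomp Require Import monoid.
From mathcomp Require Import boolp classical_sets functions reals.
From mathcomp Require Import complex.
From mathcomp Require Import mpoly.
Set Implicit Arguments.
Unset Strict Implicit.
Unset Printing Implicit Defensive.
Import GRing.Theory.
Local Open Scope classical_set_scope.
Local Open Scope ring_scope.

Record SL (K : comUnitRingType) (n : nat) : Type :=
  SLMatrix { slval : 'M[K]_n; slvalP : \det slval == 1 }.

HB.instance Definition _ (K : comUnitRingType) (n : nat) :=
  [isSub for @slval K n].
HB.instance Definition _ (K : comUnitRingType) (n : nat) :=
  [Choice of SL K n by <:].

Section SLGroup.
Variables (K : comUnitRingType) (n : nat).
Implicit Types g h : SL K n.

Lemma SL_one_subproof : \det (1%:M : 'M[K]_n) == 1.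
Proof. by rewrite det1. Qed.

Lemma SL_mul_subproof g h : \det (slval g *m slval h) == 1.
Proof. by rewrite det_mulmx (eqP (slvalP g)) (eqP (slvalP h)) mulr1. Qed.

Lemma SL_inv_subproof g : \det (invmx (slval g)) == 1.
Proof. by rewrite det_inv (eqP (slvalP g)) invr1. Qed.

Definition SL_one : SL K n := SLMatrix SL_one_subproof.
Definition SL_mul g h : SL K n := SLMatrix (SL_mul_subproof g h).
Definition SL_inv g : SL K n := SLMatrix (SL_inv_subproof g).

Lemma SL_unitmx g : slval g \in unitmx.
Proof. by rewrite unitmxE (eqP (slvalP g)) unitr1. Qed.

Lemma SL_mulA : associative SL_mul.
Proof. by move=> a b c; apply: val_inj; rewrite /= mulmxA. Qed.

Lemma SL_mul1 : left_id SL_one SL_mul.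
Proof. by move=> a; apply: val_inj; rewrite /= mul1mx. Qed.

Lemma SL_mulr1 : right_id SL_one SL_mul.
Proof. by move=> a; apply: val_inj; rewrite /= mulmx1. Qed.

Lemma SL_mulV : left_inverse SL_one SL_inv SL_mul.
Proof. by move=> a; apply: val_inj; rewrite /= mulVmx ?SL_unitmx. Qed.

Lemma SL_mulrV : right_inverse SL_one SL_inv SL_mul.
Proof. by move=> a; apply: val_inj; rewrite /= mulmxV ?SL_unitmx. Qed.

HB.instance Definition _ := isGroup.Build (SL K n)
  SL_mulA SL_mul1 SL_mulr1 SL_mulV SL_mulrV.

End SLGroup.

(* With w x1 x2 a word in two letters, this is the function tr(w(x1, x2)) of
   the pair x = (x1, x2) of generic matrices. *)
Definition word_trace (K : comUnitRingType) (n : nat)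
    (w : SL K n -> SL K n -> SL K n) (x : SL K n * SL K n) : K :=
  \tr (slval (w x.1 x.2)).

Section Invariants.
Variables (K : comUnitRingType) (n : nat).
Implicit Types f : SL K n * SL K n -> K.

(* SL_n x SL_n is closed in the affine space of pairs of matrices, so its
   regular functions are the restrictions of polynomials in the 2 n^2 entries. *)
Definition regular_function f : Prop :=
  exists p : {mpoly K[n * n + n * n]}, forall x,
    f x = p.@[row_mx (mxvec (slval x.1)) (mxvec (slval x.2)) 0].

Definition conj_invariant f : Prop :=
  forall g x, f (g * x.1 * g^-1, g * x.2 * g^-1)%g = f x.

Definition invariant_ring : set (SL K n * SL K n -> K) :=
  [set f | regular_function f /\ conj_invariant f].

End Invariants.

Arguments invariant_ring K n : clear implicits.

(* Same clauses as GRing.subalg_closed, for the algebra of all functions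
   X -> K under pointwise operations; the constants K are included. *)
Definition subalgebra (X : Type) (K : comUnitRingType) (S : set (X -> K)) :
    Prop :=
  [/\ S (fun=> 1),
      forall (a : K) f g, S f -> S g -> S (fun x => a * f x + g x)
    & forall f g, S f -> S g -> S (fun x => f x * g x)].

(* Main.v *)
Require Import Defs.
From HB Require Import structures.
From mathcomp Require Import all_boot all_order all_algebra.
From mathcomp Require Import monoid perm.
From mathcomp Require Import boolp classical_sets functions reals.
From mathcomp Require Import complex.
From mathcomp Require Import mpoly.
From mathcomp Require Import zify ring.
Set Implicit Arguments.
Unset Strict Implicit.
Unset Printing Implicit Defensive.
Import GRing.Theory.
Local Open Scope classical_set_scope.
Local Open Scope ring_scope.

(** Write d = (x, y) for a pair, let t1, t2, u1, ..., u6 be the eight generating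
traces other than that of the commutator, B the algebra that they generate,
disc the discriminant of the characteristic polynomial of x, and tanti the
difference tr[x, y] - tr[y, x].

Up to denominators.  Where disc does not vanish, x may be taken diagonal.  An
invariant regular function f is then a combination, with coefficients
polynomial in the eigenvalues of x, of monomials of weight zero for the torus
in the entries of y; these are products of the y_ii, of the y_ij y_ji, and of
the two cyclic products of length three (locspan_monoY).  All of these can be
expressed, after division by the Vandermonde product of the eigenvalues, by
u1, ..., u6 and tanti: Lagrange interpolation gives the y_ii and the diagonal
entries of y^-1, hence the y_ij y_ji; the equation det y = 1 gives the sum of
the two cyclic products, and tanti their difference.  Averaging over the
permutations of the eigenvalues turns the coefficients into polynomials in t1
and t2, so that disc^k f lies in B + B tanti for some k (locspan_regular,
locspan_invariant).

Removing the denominators.  If b in B vanishes on the locus disc = 0, then disc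
divides b in B (trace_alg_dvd).  For disc has degree three in t2 with a constant
leading coefficient, and a remainder of degree at most two in t2 has to vanish,
because a general line of constant t1 meets the curve disc = 0 in three points
(delta_dvd), while over each of these points almost all values of u1, ..., u6
are attained, with x a Jordan matrix (jordan_slice).  If b0 + b1 tanti vanishes
on disc = 0, so does b0 - b1 tanti, by transposing both matrices; hence b0 and
b1 tanti both vanish there, and disc divides b0 and b1 (full_alg_dvd).  As the
locus disc = 0 is nowhere dense (disc_cancel), one power of disc after another
cancels.

This is done first for tanti^2, which thereby lies in B and makes B + B tanti
an algebra, and then for every invariant f (invariant_full_alg).  Finally
tr[x, y] + tr[y, x] is invariant under transposition, hence lies in B, and so
tanti is a polynomial in the nine generators. *)

(** * Algebras of functions *)

Section Subalgebras.
Variables (X : Type) (K : comUnitRingType) (S : set (X -> K)).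
Hypothesis algS : subalgebra S.

Lemma subalg_ext f g : f =1 g -> S f -> S g.
Proof. by move=> /funext ->. Qed.

Lemma subalg_const (a : K) : S (fun=> a).
Proof.
have [S1 SL _] := algS.
have S0 : S (fun=> 0).
  by apply: subalg_ext (SL (-1) _ _ S1 S1) => x; rewrite mulr1 addNr.
by apply: subalg_ext (SL a _ _ S1 S0) => x; rewrite mulr1 addr0.
Qed.

Lemma subalgD f g : S f -> S g -> S (fun x => f x + g x).
Proof.
have [_ SL _] := algS.
by move=> Sf /(SL 1 _ _ Sf); apply: subalg_ext => x; rewrite mul1r.
Qed.

Lemma subalgM f g : S f -> S g -> S (fun x => f x * g x).
Proof. by have [_ _ SM] := algS; apply: SM. Qed.

Lemma subalgN f : S f -> S (fun x => - f x).
Proof.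
move=> /(subalgM (subalg_const (-1))).
by apply: subalg_ext => x; rewrite mulN1r.
Qed.

Lemma subalgB f g : S f -> S g -> S (fun x => f x - g x).
Proof. by move=> Sf /subalgN; apply: subalgD. Qed.

Lemma subalgX f k : S f -> S (fun x => f x ^+ k).
Proof.
move=> Sf; elim: k => [|k /(subalgM Sf)]; first exact: subalg_const.
by apply: subalg_ext => x; rewrite exprS.
Qed.

Lemma subalg_sum I (r : seq I) (P : pred I) (F : I -> X -> K) :
  (forall i, P i -> S (F i)) -> S (fun x => \sum_(i <- r | P i) F i x).
Proof.
move=> SF; elim: r => [|i r IH].
  by apply: subalg_ext (subalg_const 0) => x; rewrite big_nil.
have [Pi|nPi] := boolP (P i).
  by apply: subalg_ext (subalgD (SF i Pi) IH) => x; rewrite big_cons Pi.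
by apply: subalg_ext IH => x; rewrite big_cons (negPf nPi).
Qed.

Lemma subalg_prod I (r : seq I) (F : I -> X -> K) :
  (forall i, S (F i)) -> S (fun x => \prod_(i <- r) F i x).
Proof.
move=> SF; elim: r => [|i r IH].
  by apply: subalg_ext (subalg_const 1) => x; rewrite big_nil.
by apply: subalg_ext (subalgM (SF i) IH) => x; rewrite big_cons.
Qed.

Lemma subalg_meval n (p : {mpoly K[n]}) (w : X -> 'I_n -> K) :
  (forall i, S (fun x => w x i)) -> S (fun x => p.@[w x]).
Proof.
move=> Sw; apply: (@subalg_ext (fun x =>
  \sum_(m <- msupp p) p@_m * \prod_(i < n) w x i ^+ m i)).
  by move=> x; rewrite mevalE.
apply: subalg_sum => m _; apply: subalgM; first exact: subalg_const.
by apply: subalg_prod => i; apply: subalgX.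
Qed.

End Subalgebras.

(** * Explicit 3 x 3 matrices *)

Definition i0 : 'I_3 := @Ordinal 3 0 isT.
Definition i1 : 'I_3 := @Ordinal 3 1 isT.
Definition i2 : 'I_3 := @Ordinal 3 2 isT.

Lemma ord3P (P : 'I_3 -> Prop) : P i0 -> P i1 -> P i2 -> forall i, P i.
Proof.
move=> P0 P1 P2 [[|[|[|//]]] lti]; [move: P0 | move: P1 | move: P2];
  by congr P; apply: val_inj.
Qed.

Lemma big_ord3 (V : Type) (idx : V) (op : Monoid.law idx) (F : 'I_3 -> V) :
  \big[op/idx]_(i < 3) F i = op (op (F i0) (F i1)) (F i2).
Proof.
rewrite !big_ord_recr big_ord0 /= Monoid.mul1m.
by congr (op (op (F _) (F _)) (F _)); apply: val_inj.
Qed.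

Lemma det_mx22 (K : comRingType) (A : 'M[K]_2) :
  \det A = A ord0 ord0 * A ord_max ord_max - A ord0 ord_max * A ord_max ord0.
Proof.
rewrite (expand_det_row A ord0) !big_ord_recr big_ord0 /= add0r /cofactor.
rewrite !det_mx11 !mxE /= expr0 expr1 mul1r mulN1r mulrN.
by congr (A _ _ * A _ _ - A _ _ * A _ _); apply: val_inj.
Qed.

Section Matrix3.
Variable K : comUnitRingType.
Implicit Types A B : 'M[K]_3.

(** The determinant and the adjugate, written out. *)
Definition det3 A : K :=
  A i0 i0 * (A i1 i1 * A i2 i2 - A i1 i2 * A i2 i1)
  - A i0 i1 * (A i1 i0 * A i2 i2 - A i1 i2 * A i2 i0)
  + A i0 i2 * (A i1 i0 * A i2 i1 - A i1 i1 * A i2 i0).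

Lemma det_mx33 A : \det A = det3 A.
Proof.
rewrite (expand_det_row A i0) big_ord3 /= /cofactor !det_mx22 !mxE /=.
rewrite expr0 expr1 -signr_odd /= expr0 !mul1r mulN1r mulrN /det3.
by congr (_ * (A _ _ * A _ _ - A _ _ * A _ _)
  - _ * (A _ _ * A _ _ - A _ _ * A _ _)
  + _ * (A _ _ * A _ _ - A _ _ * A _ _)); apply: val_inj.
Qed.

(** The 3 x 3 matrix with the nine given entries, row by row. *)
Definition mx3 (a b c d e f g h k : K) : 'M[K]_3 :=
  \matrix_(i, j) nth 0 (nth [::] [:: [:: a; b; c]; [:: d; e; f]; [:: g; h; k]] i) j.

Lemma mx3P A B :
  A i0 i0 = B i0 i0 -> A i0 i1 = B i0 i1 -> A i0 i2 = B i0 i2 ->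
  A i1 i0 = B i1 i0 -> A i1 i1 = B i1 i1 -> A i1 i2 = B i1 i2 ->
  A i2 i0 = B i2 i0 -> A i2 i1 = B i2 i1 -> A i2 i2 = B i2 i2 -> A = B.
Proof. by move=> *; apply/matrixP; do 2![apply: ord3P]. Qed.

Definition adj3 A : 'M[K]_3 :=
  mx3 (A i1 i1 * A i2 i2 - A i1 i2 * A i2 i1)
      (A i0 i2 * A i2 i1 - A i0 i1 * A i2 i2)
      (A i0 i1 * A i1 i2 - A i0 i2 * A i1 i1)
      (A i1 i2 * A i2 i0 - A i1 i0 * A i2 i2)
      (A i0 i0 * A i2 i2 - A i0 i2 * A i2 i0)
      (A i0 i2 * A i1 i0 - A i0 i0 * A i1 i2)
      (A i1 i0 * A i2 i1 - A i1 i1 * A i2 i0)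
      (A i0 i1 * A i2 i0 - A i0 i0 * A i2 i1)
      (A i0 i0 * A i1 i1 - A i0 i1 * A i1 i0).

Lemma mul_mx_adj3 A : A *m adj3 A = (\det A)%:M.
Proof.
rewrite det_mx33 /det3; apply: mx3P; rewrite !mxE big_ord3 /= !mxE /=; ring.
Qed.

Lemma tr3 A : \tr A = A i0 i0 + A i1 i1 + A i2 i2.
Proof. by rewrite /mxtrace big_ord3. Qed.

Lemma tr3M A B : \tr (A *m B) =
  A i0 i0 * B i0 i0 + A i0 i1 * B i1 i0 + A i0 i2 * B i2 i0 +
  (A i1 i0 * B i0 i1 + A i1 i1 * B i1 i1 + A i1 i2 * B i2 i1) +
  (A i2 i0 * B i0 i2 + A i2 i1 * B i1 i2 + A i2 i2 * B i2 i2).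
Proof. by rewrite tr3 !mxE !big_ord3. Qed.

Lemma det_mx3 (a b c d e f g h k : K) :
  \det (mx3 a b c d e f g h k) =
  a * (e * k - f * h) - b * (d * k - f * g) + c * (d * h - e * g).
Proof. by rewrite det_mx33 /det3 !mxE. Qed.

Lemma adj3_mx3 (a b c d e f g h k : K) :
  adj3 (mx3 a b c d e f g h k) =
  mx3 (e * k - f * h) (c * h - b * k) (b * f - c * e)
      (f * g - d * k) (a * k - c * g) (c * d - a * f)
      (d * h - e * g) (b * g - a * h) (a * e - b * d).
Proof. by apply: mx3P; rewrite !mxE. Qed.

Lemma tr_mx3 (a b c d e f g h k : K) :
  \tr (mx3 a b c d e f g h k) = a + e + k.
Proof. by rewrite tr3 !mxE. Qed.

Lemma mul_mx3 (a b c d e f g h k a' b' c' d' e' f' g' h' k' : K) :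
  mx3 a b c d e f g h k *m mx3 a' b' c' d' e' f' g' h' k' =
  mx3 (a * a' + b * d' + c * g') (a * b' + b * e' + c * h') (a * c' + b * f' + c * k')
      (d * a' + e * d' + f * g') (d * b' + e * e' + f * h') (d * c' + e * f' + f * k')
      (g * a' + h * d' + k * g') (g * b' + h * e' + k * h') (g * c' + h * f' + k * k').
Proof. by apply: mx3P; rewrite !mxE big_ord3 !mxE. Qed.

End Matrix3.

(** * Regular functions on SL_3 x SL_3 *)

Section RegularFunctions.
Variable C : numClosedFieldType.
Local Notation G := (SL C 3).
Implicit Types (d : G * G) (f : G * G -> C).

(** The two matrices of a pair. *)
Definition mxX d : 'M[C]_3 := slval d.1.
Definition mxY d : 'M[C]_3 := slval d.2.

Lemma detX d : \det (mxX d) = 1. Proof. exact/eqP/(slvalP d.1). Qed.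
Lemma detY d : \det (mxY d) = 1. Proof. exact/eqP/(slvalP d.2). Qed.

Lemma slvalM (g h : G) : slval (g * h)%g = slval g *m slval h.
Proof. by []. Qed.

Lemma slvalV (g : G) : slval (g^-1)%g = adj3 (slval g).
Proof.
have u : slval g \in unitmx := SL_unitmx g.
rewrite -[RHS](mulKmx u) mul_mx_adj3 (eqP (slvalP g)) mulmx1.
by [].
Qed.

Lemma SL_eq (d d' : G * G) : mxX d = mxX d' -> mxY d = mxY d' -> d = d'.
Proof.
by case: d d' => [x y] [x' y'] eX eY; congr pair; apply: val_inj.
Qed.

Lemma ex_pair (A B : 'M[C]_3) : \det A = 1 -> \det B = 1 ->
  exists d, mxX d = A /\ mxY d = B.
Proof.
move=> /eqP dA /eqP dB; by exists (SLMatrix dA, SLMatrix dB).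
Qed.

Lemma regular_ext f g : f =1 g -> regular_function f -> regular_function g.
Proof. by move=> e [p pE]; exists p => x; rewrite -e. Qed.

Lemma regular_subalg : subalgebra (@regular_function C 3).
Proof.
split=> [|a f g [p pE] [q qE]|f g [p pE] [q qE]].
- by exists 1 => x; rewrite meval1.
- by exists (a *: p + q) => x; rewrite mevalD mevalZ pE qE.
- by exists (p * q) => x; rewrite mevalM pE qE.
Qed.

Lemma regular_X i j : regular_function (fun d => mxX d i j).
Proof.
exists 'X_(lshift _ (mxvec_index i j)) => x.
by rewrite mevalXU row_mxEl mxvecE.
Qed.

Lemma regular_Y i j : regular_function (fun d => mxY d i j).
Proof.
exists 'X_(rshift _ (mxvec_index i j)) => x.
by rewrite mevalXU row_mxEr mxvecE.
Qed.

(** Matrices whose entries are regular functions of the pair. *)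
Definition regular_mx (F : G * G -> 'M[C]_3) :=
  forall i j, regular_function (fun d => F d i j).

Lemma regular_mxM F F' : regular_mx F -> regular_mx F' ->
  regular_mx (fun d => F d *m F' d).
Proof.
move=> rF rF' i j; apply: regular_ext.
  by move=> d; rewrite mxE big_ord3.
have A := regular_subalg.
by apply: (subalgD A); first apply: (subalgD A); apply: (subalgM A).
Qed.

Lemma regular_adj3 F : regular_mx F -> regular_mx (fun d => adj3 (F d)).
Proof.
move=> rF; have A := regular_subalg.
by do 2!apply: ord3P;
  (apply: regular_ext; first by move=> d; rewrite mxE /=);
  apply: (subalgB A); apply: (subalgM A).
Qed.

Lemma regular_tr F : regular_mx F -> regular_function (fun d => \tr (F d)).
Proof.
move=> rF; apply: regular_ext; first by move=> d; rewrite tr3.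
have A := regular_subalg.
by apply: (subalgD A); first apply: (subalgD A).
Qed.

End RegularFunctions.

(** * Polynomials vanishing on large sets *)

Section Density.
Variable C : numClosedFieldType.

Lemma poly_vanish (q h : {poly C}) : h != 0 ->
  (forall s, h.[s] != 0 -> q.[s] = 0) -> q = 0.
Proof.
move=> h0 qv; have qh s : (q * h).[s] = 0.
  by rewrite hornerM; case: (eqVneq h.[s] 0) => [->|/qv ->]; rewrite ?mulr0 ?mul0r.
suff /eqP : q * h = 0 by rewrite mulf_eq0 (negPf h0) orbF => /eqP.
apply/eqP; apply/negPn/negP => qh0.
have := max_poly_roots (rs := [seq (i%:R : C) | i <- iota 0 (size (q * h))]) qh0.
rewrite size_map size_iota ltnn => F.
suff: false by []; apply: F.
  by apply/allP => x _; rewrite /root qh.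
rewrite map_inj_uniq ?iota_uniq // => a b /eqP.
by rewrite Num.Theory.eqr_nat => /eqP.
Qed.

Lemma poly_vanish1 (q h : {poly C}) a : h.[a] != 0 ->
  (forall s, h.[s] != 0 -> q.[s] = 0) -> q = 0.
Proof.
by move=> ha; apply: poly_vanish; apply: contraNneq ha => ->; rewrite horner0.
Qed.

(** The restriction of a polynomial to a polynomial curve is a polynomial. *)
Lemma meval_curve n (p : {mpoly C[n]}) (w : 'I_n -> {poly C}) :
  exists q : {poly C}, forall s, q.[s] = p.@[fun i => (w i).[s]].
Proof.
exists (mmap polyC w p) => s; rewrite mevalE /mmap horner_sum.
apply: eq_bigr => m _; rewrite hornerM hornerC; congr (_ * _).
by rewrite /mmap1 horner_prod; apply: eq_bigr => i _; rewrite horner_exp.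
Qed.

Lemma meval_line n (p : {mpoly C[n]}) (a b : 'I_n -> C) :
  exists q : {poly C}, forall s, q.[s] = p.@[fun i => a i + s * (b i - a i)].
Proof.
have [q qE] := meval_curve p (fun i => (a i)%:P + 'X * (b i - a i)%:P).
by exists q => s; rewrite qE; apply: meval_eq => i; rewrite !hornerE.
Qed.

(** Affine subspaces are irreducible: on the points with a given coordinate,
    one of the factors of a vanishing product vanishes. *)
Lemma meval_domain n (k : 'I_n) (c : C) (p h : {mpoly C[n]}) :
  (forall v, v k = c -> h.@[v] != 0 -> p.@[v] = 0) ->
  (exists2 v, v k = c & h.@[v] != 0) ->
  forall v, v k = c -> p.@[v] = 0.
Proof.
move=> pv [b bk hb] a ak.
have [q qE] := meval_line p a b; have [g gE] := meval_line h a b.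
have q0 : q = 0.
  apply: (@poly_vanish1 q g 1).
    by rewrite gE (meval_eq (v2 := b)) // => i; rewrite mul1r addrC subrK.
  by move=> s; rewrite gE qE => /pv -> //; rewrite ak bk subrr mulr0 addr0.
rewrite -(meval_eq (v1 := fun i => a i + 0 * (b i - a i))) => [|i].
  by rewrite -qE q0 horner0.
by rewrite mul0r addr0.
Qed.

(** A Laurent polynomial function of a nonzero parameter. *)
Definition laurent (h : C -> C) :=
  exists (N : nat) (q : {poly C}), forall w, w != 0 -> w ^+ N * h w = q.[w].

Lemma laurent_const c : laurent (fun=> c).
Proof. by exists 0%N, c%:P => w _; rewrite hornerC expr0 mul1r. Qed.

Lemma laurent_id : laurent id.
Proof. by exists 0%N, 'X => w _; rewrite hornerX expr0 mul1r. Qed.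

Lemma laurent_inv : laurent GRing.inv.
Proof. by exists 1%N, 1 => w w0; rewrite hornerC expr1 mulfV. Qed.

Lemma laurentD g h : laurent g -> laurent h -> laurent (fun w => g w + h w).
Proof.
move=> [M [p pE]] [N [q qE]]; exists (M + N)%N, ('X^N * p + 'X^M * q) => w w0.
by rewrite hornerD !hornerM !hornerXn -pE // -qE // exprD; ring.
Qed.

Lemma laurentM g h : laurent g -> laurent h -> laurent (fun w => g w * h w).
Proof.
move=> [M [p pE]] [N [q qE]]; exists (M + N)%N, (p * q) => w w0.
by rewrite hornerM -pE // -qE // exprD; ring.
Qed.

Lemma laurent_ext g h : g =1 h -> laurent g -> laurent h.
Proof. by move=> e [N [q qE]]; exists N, q => w w0; rewrite -e qE. Qed.

Lemma laurent_meval n (p : {mpoly C[n]}) (h : 'I_n -> C -> C) :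
  (forall i, laurent (h i)) -> laurent (fun w => p.@[fun i => h i w]).
Proof.
move=> lh; apply: (@laurent_ext (fun w =>
  \sum_(m <- msupp p) p@_m * \prod_i h i w ^+ m i)).
  by move=> w; rewrite mevalE.
elim: (msupp p) => [|m s IH].
  by apply: laurent_ext (laurent_const 0) => w; rewrite big_nil.
apply: (@laurent_ext (fun w => p@_m * \prod_i h i w ^+ m i +
   \sum_(m <- s) p@_m * \prod_i h i w ^+ m i)).
  by move=> w; rewrite big_cons.
apply: laurentD => //; apply: laurentM; first exact: laurent_const.
elim: (index_enum _) => [|i r IHr].
  by apply: laurent_ext (laurent_const 1) => w; rewrite big_nil.
apply: (@laurent_ext (fun w => h i w ^+ m i * \prod_(i <- r) h i w ^+ m i)).
  by move=> w; rewrite big_cons.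
apply: laurentM => //; elim: (m i) => [|k IHk].
  by apply: laurent_ext (laurent_const 1) => w; rewrite expr0.
apply: (@laurent_ext (fun w => h i w * h i w ^+ k)).
  by move=> w; rewrite exprS.
by apply: laurentM.
Qed.

Lemma laurent_vanish (g : C -> C) (h : {poly C}) : laurent g -> h != 0 ->
  (forall w, w != 0 -> h.[w] != 0 -> g w = 0) -> g 1 = 0.
Proof.
move=> [N [q qE]] h0 gv.
have q0 : q = 0.
  apply: (@poly_vanish q (h * 'X)); first by rewrite mulf_neq0 // polyX_eq0.
  move=> w; rewrite hornerM hornerX mulf_eq0 negb_or => /andP[hw w0].
  by rewrite -qE // gv // mulr0.
by have := qE 1 (oner_neq0 _); rewrite q0 horner0 expr1n mul1r.
Qed.

End Density.

(** * Divisibility by the discriminant *)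

Section Discriminant.
Variable C : numClosedFieldType.
Implicit Types (a b c e r t : C).

Lemma lincomb1 (x y k a b : C) : x - y = k * (a - b) -> a = b -> x = y.
Proof. by move=> e ab; apply: subr0_eq; rewrite e ab subrr mulr0. Qed.

Lemma lincomb2 (x y k a b l c d : C) :
  x - y = k * (a - b) + l * (c - d) -> a = b -> c = d -> x = y.
Proof.
by move=> e ab cd; apply: subr0_eq; rewrite e ab cd !subrr !mulr0 addr0.
Qed.

Lemma lincomb3 (x y k a b l c d m e f : C) :
  x - y = k * (a - b) + l * (c - d) + m * (e - f) ->
  a = b -> c = d -> e = f -> x = y.
Proof.
by move=> E ab cd ef; apply: subr0_eq; rewrite E ab cd ef !subrr !mulr0 !addr0.
Qed.

Lemma nat_neq0 n : (n.+1)%:R != 0 :> C.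
Proof. by rewrite Num.Theory.pnatr_eq0. Qed.

(** The discriminant of X^3 - a X^2 + b X - 1. *)
Definition delta a b : C :=
  a ^+ 2 * b ^+ 2 - 4%:R * a ^+ 3 - 4%:R * b ^+ 3 + 18%:R * a * b - 27%:R.

(** The traces of x and of its inverse when x has eigenvalues r, r, r^-2;
    these are the points of the curve delta = 0. *)
Definition dbl1 r : C := 2%:R * r + r^-1 ^+ 2.
Definition dbl2 r : C := r ^+ 2 + 2%:R * r^-1.

Lemma delta_dbl r : r != 0 -> delta (dbl1 r) (dbl2 r) = 0.
Proof. by move=> r0; rewrite /delta /dbl1 /dbl2; field. Qed.

Lemma delta_factor x y z : x * y * z = 1 ->
  delta (x + y + z) (x * y + y * z + z * x) =
  ((x - y) * (x - z) * (y - z)) ^+ 2.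
Proof.
move=> h; set e1 := x + y + z; set e2 := x * y + y * z + z * x.
set e3 := x * y * z in h.
have -> : ((x - y) * (x - z) * (y - z)) ^+ 2 =
  e1 ^+ 2 * e2 ^+ 2 - 4%:R * e1 ^+ 3 * e3 - 4%:R * e2 ^+ 3
  + 18%:R * e1 * e2 * e3 - 27%:R * e3 ^+ 2 by rewrite /e1 /e2 /e3; ring.
by rewrite h /delta !mulr1 expr1n mulr1.
Qed.

(** The roots of X^3 + c2 X^2 + c1 X + c0, through Viete's formulas. *)
Lemma cubic_roots (c2 c1 c0 : C) : exists a b e : C,
  [/\ a + b + e = - c2, a * b + b * e + e * a = c1 & a * b * e = - c0].
Proof.
set p : {poly C} := 'X^3 + Poly [:: c0; c1; c2].
have sp : (size (Poly [:: c0; c1; c2]) < size ('X^3 : {poly C}))%N.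
  by rewrite size_polyXn (leq_ltn_trans (size_Poly _)).
have [s sE] := closed_field_poly_normal p.
have lp : lead_coef p = 1 by rewrite lead_coefDl ?lead_coefXn.
rewrite lp scale1r in sE.
have : size p = 4%N by rewrite size_polyDl // size_polyXn.
rewrite {1}sE size_prod_XsubC; case: s sE => [|a [|b [|e [|//]]]] // sE _.
have ev x : x ^+ 3 + c2 * x ^+ 2 + c1 * x + c0 = (x - a) * ((x - b) * (x - e)).
  have := congr1 (horner^~ x) sE; rewrite /= /p !big_cons big_nil mulr1.
  rewrite !(hornerD, hornerM, hornerXn, horner_Poly, hornerN, hornerX, hornerC) /=.
  by move=> <-; ring.
have := ev 0; have := ev 1; have := ev (-1).
move=> hm h1 h0; exists a, b, e.
have n2 := nat_neq0 1.
have E0 : a * b * e = - c0 by apply: (lincomb1 (k := 1) _ h0); ring.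
split=> //.
  apply: (mulfI n2); apply: (lincomb3 (k := 1) (l := 1) (m := - 2%:R) _ h1 hm h0).
  by ring.
by apply: (mulfI n2); apply: (lincomb2 (k := - 1) (l := 1) _ h1 hm); ring.
Qed.

(** A vertical line meets the curve delta = 0 in three distinct points, for all
    but finitely many such lines. *)
Lemma three_dbl c : c ^+ 3 != 27%:R -> exists r1 r2 r3 : C,
  [/\ uniq [:: dbl2 r1; dbl2 r2; dbl2 r3]
    & all (fun r => [&& r != 0, r ^+ 3 != 1 & dbl1 r == c]) [:: r1; r2; r3]].
Proof.
move=> hc; have n2 := nat_neq0 1.
have [a [b [e [s1 s2 s3]]]] := cubic_roots (- (c / 2%:R)) 0 (2%:R^-1).
rewrite opprK in s1.
(* the r are the roots of 2 X^3 - c X^2 + 1; by their relations dbl2 is a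
   quadratic polynomial on them, and any coincidence forces c^3 = 27 *)
have key (x y z : C) : x + y + z = c / 2%:R -> x * y + y * z + z * x = 0 ->
    x * y * z = - 2%:R^-1 ->
  [/\ dbl2 x = 2%:R * c * x - 3%:R * x ^+ 2, dbl2 x != dbl2 y,
      x != 0, x ^+ 3 != 1 & dbl1 x = c].
  have step (x' y' z' : C) : x' + y' + z' = c / 2%:R ->
      x' * y' + y' * z' + z' * x' = 0 -> x' * y' * z' = - 2%:R^-1 ->
    [/\ dbl2 x' = 2%:R * c * x' - 3%:R * x' ^+ 2, x' != 0, x' ^+ 3 != 1,
        dbl1 x' = c & 6%:R * x' != - c].
    move=> e1 e2 e3.
    have x0 : x' != 0.
      apply: contraNneq n2 => x0; move/eqP: e3.
      by rewrite x0 !mul0r eq_sym oppr_eq0 invr_eq0.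
    have cE : c = 2%:R * (x' + y' + z') by rewrite e1; field.
    have xV : x'^-1 = - (2%:R * y' * z').
      apply: (mulfI x0); rewrite mulfV //.
      by apply: (lincomb1 (k := 2%:R) _ e3); field.
    have yz : y' * z' = - (x' * (y' + z')).
      by apply: (lincomb1 (k := 1) _ e2); ring.
    have d1 : dbl1 x' = c.
      apply: (mulfI x0); rewrite /dbl1 mulrDr expr2 mulrA (mulrA _ x'^-1) mulfV //.
      rewrite mul1r cE.
      have -> : x'^-1 = 2%:R * x' * (y' + z') by rewrite xV -mulrA yz; ring.
      by ring.
    have cub : 2%:R * x' ^+ 3 + 1 = c * x' ^+ 2.
      by rewrite -d1 /dbl1; field.
    split=> //.
    - by rewrite /dbl2 xV -mulrA yz cE; ring.
    - apply: contraNneq hc => x3; rewrite -d1 /dbl1.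
      have -> : x'^-1 ^+ 2 = x'.
        by rewrite exprVn -[LHS]mul1r -{1}x3; field.
      have -> : 2%:R * x' + x' = 3%:R * x' by ring.
      by rewrite exprMn x3 mulr1 -natrX.
    - apply: contraNneq hc => xc.
      apply/eqP; have cE' : c = - (6%:R * x') by rewrite xc opprK.
      rewrite cE' in cub *.
      by apply: (lincomb1 (k := -27%:R) _ cub); ring.
  move=> e1 e2 e3.
  have [dx x0 x3 dx1 _] := step x y z e1 e2 e3.
  have [dy y0 y3 dy1 _] : [/\ dbl2 y = 2%:R * c * y - 3%:R * y ^+ 2, y != 0,
      y ^+ 3 != 1, dbl1 y = c & 6%:R * y != - c].
    apply: (step y x z).
    - by rewrite -e1; ring.
    - by rewrite -e2; ring.
    - by rewrite -e3; ring.
  have [_ _ _ _ z6] : [/\ dbl2 z = 2%:R * c * z - 3%:R * z ^+ 2, z != 0,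
      z ^+ 3 != 1, dbl1 z = c & 6%:R * z != - c].
    apply: (step z x y).
    - by rewrite -e1; ring.
    - by rewrite -e2; ring.
    - by rewrite -e3; ring.
  have cE : c = 2%:R * (x + y + z) by rewrite e1; field.
  split=> //; apply: contraNneq z6 => dxy; apply/eqP.
  case: (eqVneq x y) => [xy|nxy].
    have : x * (x + 2%:R * z) = 0 by rewrite -e2 -xy; ring.
    move=> /eqP; rewrite mulf_eq0 (negPf x0) /= => /eqP h.
    by rewrite cE -xy; apply: (lincomb1 (k := 4%:R) _ h); ring.
  have : (x - y) * (c + 6%:R * z) = 0.
    rewrite dx dy in dxy; apply: (lincomb1 (k := 2%:R) _ dxy).
    by rewrite cE; ring.
  move=> /eqP; rewrite mulf_eq0 subr_eq0 (negPf nxy) /= addrC => /eqP h.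
  by apply: (lincomb1 (k := 1) _ h); ring.
have [_ ab a0 a3 ac] := key a b e s1 s2 s3.
have [_ be b0 b3 bc] : [/\ dbl2 b = 2%:R * c * b - 3%:R * b ^+ 2,
    dbl2 b != dbl2 e, b != 0, b ^+ 3 != 1 & dbl1 b = c].
  by apply: (key b e a); rewrite -?s1 -?s2 -?s3; ring.
have [_ ea e0 e3 ec] : [/\ dbl2 e = 2%:R * c * e - 3%:R * e ^+ 2,
    dbl2 e != dbl2 a, e != 0, e ^+ 3 != 1 & dbl1 e = c].
  by apply: (key e a b); rewrite -?s1 -?s2 -?s3; ring.
exists a, b, e; split.
  by rewrite /= !inE negb_or ab be (eq_sym (dbl2 a)) ea.
by rewrite /= a0 a3 ac b0 b3 bc e0 e3 ec eqxx.
Qed.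

Lemma quadratic_vanish (c0 c1 c2 : C) (s : seq C) : size s = 3%N -> uniq s ->
  (forall t, t \in s -> c0 + c1 * t + c2 * t ^+ 2 = 0) ->
  [/\ c0 = 0, c1 = 0 & c2 = 0].
Proof.
move=> s3 us h; pose p := Poly [:: c0; c1; c2].
have p0 : p = 0.
  apply/eqP; apply/negPn/negP => /max_poly_roots/(_ _ us).
  rewrite s3 ltnNge size_Poly => F; suff: false by []; apply: F.
  apply/allP => t ts; rewrite /root horner_Poly /= mul0r add0r -(h t ts).
  by apply/eqP; ring.
have E i : p`_i = [:: c0; c1; c2]`_i by rewrite coef_Poly.
by split; [have := E 0 | have := E 1 | have := E 2]; rewrite p0 coef0.
Qed.

(** The value at (v, t) of a polynomial in eight variables, seen as a
    polynomial in the last one. *)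
Definition eval8 (P : {poly {mpoly C[7]}}) (v : 'I_7 -> C) t : C :=
  (P.[t%:MP]).@[v].

Lemma eval8D P Q v t : eval8 (P + Q) v t = eval8 P v t + eval8 Q v t.
Proof. by rewrite /eval8 hornerD mevalD. Qed.

Lemma eval8M P Q v t : eval8 (P * Q) v t = eval8 P v t * eval8 Q v t.
Proof. by rewrite /eval8 hornerM mevalM. Qed.

Lemma eval8C (p : {mpoly C[7]}) v t : eval8 p%:P v t = p.@[v].
Proof. by rewrite /eval8 hornerC. Qed.

Lemma delta_dvd (P : {poly {mpoly C[7]}}) :
  (forall r v, r != 0 -> r ^+ 3 != 1 -> v ord0 = dbl1 r ->
     eval8 P v (dbl2 r) = 0) ->
  exists Q, forall v t, eval8 P v t = delta (v ord0) t * eval8 Q v t.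
Proof.
move=> Pv; have n4 := nat_neq0 3.
pose x : {mpoly C[7]} := 'X_ord0.
(* as a polynomial in its second argument, delta has leading term -4 X^3, so
   that D below is monic with delta = -4 D *)
pose L := Poly [:: x ^+ 3 + (27%:R / 4%:R)%:MP; (- (18%:R / 4%:R))%:MP * x;
                   (- 4%:R^-1)%:MP * x ^+ 2].
pose D := 'X^3 + L.
have sL : (size L < size ('X^3 : {poly {mpoly C[7]}}))%N.
  by rewrite size_polyXn (leq_ltn_trans (size_Poly _)).
have mD : D \is monic by rewrite monicE lead_coefDl ?lead_coefXn.
have sD : size D = 4%N by rewrite size_polyDl // size_polyXn.
have DE v t : delta (v ord0) t = - 4%:R * eval8 D v t.
  rewrite /eval8 /D /L hornerD hornerXn horner_Poly /= mul0r add0r.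
  rewrite !(mevalD, mevalM, rmorphXn, mevalC) /= !(mevalXU, mevalC) /delta.
  by field.
have := Pdiv.RingMonic.rdivp_eq mD P.
set Q := Pdiv.Ring.rdivp P D; set R := Pdiv.Ring.rmodp P D => PE.
have sR : (size R <= 3)%N.
  have : (size R < size D)%N by rewrite Pdiv.Ring.ltn_rmodp monic_neq0.
  by rewrite sD.
have RE v t : eval8 R v t = (R`_0).@[v] + (R`_1).@[v] * t + (R`_2).@[v] * t ^+ 2.
  rewrite /eval8 (horner_coef_wide _ sR) !big_ord_recl big_ord0 /=.
  rewrite !(mevalD, mevalM, rmorphXn, mevalC) /= ?expr0 ?meval1 /bump /=.
  by rewrite !addn0 expr1 mevalC; ring.
have R0 v : [/\ (R`_0).@[v] = 0, (R`_1).@[v] = 0 & (R`_2).@[v] = 0].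
  have gen w : w ord0 ^+ 3 != 27%:R ->
      [/\ (R`_0).@[w] = 0, (R`_1).@[w] = 0 & (R`_2).@[w] = 0].
    move=> /three_dbl [r1 [r2 [r3 [u]]]] /= /and4P[h1 h2 h3 _].
    have vr r : [&& r != 0, r ^+ 3 != 1 & dbl1 r == w ord0] ->
        (R`_0).@[w] + (R`_1).@[w] * dbl2 r + (R`_2).@[w] * dbl2 r ^+ 2 = 0.
      case/and3P=> r0 r3' /eqP rc; rewrite -RE.
      have := Pv r w r0 r3' (esym rc); rewrite PE eval8D eval8M => /eqP.
      have /eqP := DE w (dbl2 r); rewrite -rc delta_dbl // eq_sym mulf_eq0.
      by rewrite oppr_eq0 (negPf n4) /= => /eqP ->; rewrite mulr0 add0r => /eqP.
    apply: (quadratic_vanish (s := [:: dbl2 r1; dbl2 r2; dbl2 r3])) => // t.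
    by rewrite !inE => /or3P[] /eqP ->; apply: vr.
  (* the exceptional values of the first coordinate are avoided on a line *)
  have all0 (p : {mpoly C[7]}) :
      (forall w, w ord0 ^+ 3 != 27%:R -> p.@[w] = 0) -> p.@[v] = 0.
    move=> pv; have [q qE] := meval_line p v (fun i => v i + 1).
    pose h : {poly C} := ((v ord0)%:P + 'X) ^+ 3 - (27%:R)%:P.
    have hE s : h.[s] = (v ord0 + s) ^+ 3 - 27%:R.
      by rewrite /h hornerD hornerN horner_exp hornerD !hornerC hornerX.
    have q0 : q = 0.
      apply: (@poly_vanish1 _ q h (- v ord0)).
        by rewrite hE subrr expr0n sub0r oppr_eq0 nat_neq0.
      move=> s; rewrite hE subr_eq0 qE => hs; apply: pv.
      by rewrite addrAC subrr add0r mulr1.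
    rewrite -(meval_eq (v1 := fun i => v i + 0 * (v i + 1 - v i))) => [|i].
      by rewrite -qE q0 horner0.
    by rewrite mul0r addr0.
  by split; apply: all0 => w /gen[].
exists ((- 4%:R^-1)%:MP%:P * Q) => v t.
have [h0 h1 h2] := R0 v.
rewrite {1}PE eval8D eval8M RE h0 h1 h2 DE eval8M eval8C mevalC.
by field.
Qed.

End Discriminant.

(** * The generating traces *)

Section Traces.
Variable C : numClosedFieldType.
Local Notation G := (SL C 3).
Implicit Types (d : G * G) (f : G * G -> C) (v : 'I_7 -> C).

(** The traces of x_1 and of its inverse, which determine the characteristic
    polynomial of x_1, and the remaining six traces in the list of generators
    other than that of the commutator. *)
Definition t1 : G * G -> C := word_trace (fun x y => x).
Definition t2 : G * G -> C := word_trace (fun x y => x^-1)%g.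
Definition u1 : G * G -> C := word_trace (fun x y => y).
Definition u2 : G * G -> C := word_trace (fun x y => x * y)%g.
Definition u3 : G * G -> C := word_trace (fun x y => x^-1 * y)%g.
Definition u4 : G * G -> C := word_trace (fun x y => y^-1)%g.
Definition u5 : G * G -> C := word_trace (fun x y => x * y^-1)%g.
Definition u6 : G * G -> C := word_trace (fun x y => x^-1 * y^-1)%g.
(** The traces of the commutator and of its inverse. *)
Definition tc : G * G -> C := word_trace (fun x y => x * y * x^-1 * y^-1)%g.
Definition tc' : G * G -> C := word_trace (fun x y => y * x * y^-1 * x^-1)%g.

Lemma t1E d : t1 d = \tr (mxX d). Proof. by []. Qed.
Lemma t2E d : t2 d = \tr (adj3 (mxX d)).
Proof. by rewrite /t2 /word_trace slvalV. Qed.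
Lemma u1E d : u1 d = \tr (mxY d). Proof. by []. Qed.
Lemma u2E d : u2 d = \tr (mxX d *m mxY d). Proof. by []. Qed.
Lemma u3E d : u3 d = \tr (adj3 (mxX d) *m mxY d).
Proof. by rewrite /u3 /word_trace slvalM slvalV. Qed.
Lemma u4E d : u4 d = \tr (adj3 (mxY d)).
Proof. by rewrite /u4 /word_trace slvalV. Qed.
Lemma u5E d : u5 d = \tr (mxX d *m adj3 (mxY d)).
Proof. by rewrite /u5 /word_trace slvalM slvalV. Qed.
Lemma u6E d : u6 d = \tr (adj3 (mxX d) *m adj3 (mxY d)).
Proof. by rewrite /u6 /word_trace slvalM !slvalV. Qed.
Lemma tcE d :
  tc d = \tr (mxX d *m mxY d *m (adj3 (mxX d) *m adj3 (mxY d))).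
Proof. by rewrite /tc /word_trace !slvalM !slvalV !mulmxA. Qed.
Lemma tc'E d :
  tc' d = \tr (mxY d *m mxX d *m (adj3 (mxY d) *m adj3 (mxX d))).
Proof. by rewrite /tc' /word_trace !slvalM !slvalV !mulmxA. Qed.

(** The traces other than t2, in the order of the variables of eval8. *)
Definition coords d : 'I_7 -> C :=
  fun i => nth 0 [:: t1 d; u1 d; u2 d; u3 d; u4 d; u5 d; u6 d] i.

(** The antisymmetric part of the trace of the commutator. *)
Definition tanti d : C := tc d - tc' d.

(** The discriminant of the characteristic polynomial of x_1. *)
Definition disc d : C := delta (t1 d) (t2 d).

(** The value at a pair of a polynomial in the eight traces. *)
Definition trace_poly (P : {poly {mpoly C[7]}}) d : C :=
  eval8 P (coords d) (t2 d).

(** The algebra generated by the eight traces. *)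
Definition trace_alg f := exists P, forall d, f d = trace_poly P d.

Lemma trace_alg_subalg : subalgebra trace_alg.
Proof.
split=> [|a f g [P PE] [Q QE]|f g [P PE] [Q QE]].
- by exists 1%:MP%:P => d; rewrite /trace_poly eval8C mevalC.
- exists (a%:MP%:P * P + Q) => d.
  by rewrite /trace_poly eval8D eval8M eval8C mevalC PE QE.
- by exists (P * Q) => d; rewrite /trace_poly eval8M PE QE.
Qed.

Lemma trace_alg_coord (i : 'I_7) : trace_alg (fun d => coords d i).
Proof. by exists ('X_i)%:P => d; rewrite /trace_poly eval8C mevalXU. Qed.

Lemma trace_alg_t2 : trace_alg t2.
Proof. by exists 'X => d; rewrite /trace_poly /eval8 hornerX mevalC. Qed.

Lemma trace_alg_t1 : trace_alg t1.
Proof. exact: (trace_alg_coord (@Ordinal 7 0 isT)). Qed.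
Lemma trace_alg_u1 : trace_alg u1.
Proof. exact: (trace_alg_coord (@Ordinal 7 1 isT)). Qed.
Lemma trace_alg_u2 : trace_alg u2.
Proof. exact: (trace_alg_coord (@Ordinal 7 2 isT)). Qed.
Lemma trace_alg_u3 : trace_alg u3.
Proof. exact: (trace_alg_coord (@Ordinal 7 3 isT)). Qed.
Lemma trace_alg_u4 : trace_alg u4.
Proof. exact: (trace_alg_coord (@Ordinal 7 4 isT)). Qed.
Lemma trace_alg_u5 : trace_alg u5.
Proof. exact: (trace_alg_coord (@Ordinal 7 5 isT)). Qed.
Lemma trace_alg_u6 : trace_alg u6.
Proof. exact: (trace_alg_coord (@Ordinal 7 6 isT)). Qed.

(** Hence trace_alg is the subalgebra generated by the eight traces. *)
Lemma trace_alg_min (S : set (G * G -> C)) : subalgebra S ->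
  S t1 -> S t2 -> S u1 -> S u2 -> S u3 -> S u4 -> S u5 -> S u6 ->
  forall f, trace_alg f -> S f.
Proof.
move=> algS h1 h2 k1 k2 k3 k4 k5 k6 f [P PE].
apply: (@subalg_ext _ _ _ (fun d =>
  \sum_(i < size P) (P`_i).@[coords d] * t2 d ^+ i)).
  move=> d; rewrite PE /trace_poly /eval8 horner_coef raddf_sum.
  by apply: eq_bigr => i _; rewrite /= mevalM rmorphXn /= mevalC.
apply: (subalg_sum algS) => i _; apply: (subalgM algS); last exact: subalgX.
by apply: (subalg_meval algS) => -[[|[|[|[|[|[|[|//]]]]]]] lti].
Qed.

(** ** Invariance *)

(** Simultaneous conjugacy under GL_3. *)
Definition conjugate d d' := exists2 P : 'M[C]_3, P \in unitmx &
  mxX d' *m P = P *m mxX d /\ mxY d' *m P = P *m mxY d.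

(** Conjugation by GL_3 factors through SL_3, since every determinant is a
    cube. *)
Lemma invariant_conjugate f d d' :
  conj_invariant f -> conjugate d d' -> f d' = f d.
Proof.
move=> fi [P uP [eX eY]]; have P0 : \det P != 0 by rewrite -unitfE -unitmxE.
pose c := Num.Theory.nthroot 3 (\det P).
have c3 : c ^+ 3 = \det P by rewrite Num.Theory.rootCK.
have c0 : c != 0 by apply: contraNneq P0; rewrite -c3 => ->; rewrite expr0n.
have dg : \det (c^-1 *: P) == 1 by rewrite detZ exprVn c3 mulVf.
pose g : G := SLMatrix dg.
rewrite -(fi g d); congr f.
have cj (A : 'M[C]_3) :
    (c^-1 *: P) *m A *m invmx (c^-1 *: P) = P *m A *m invmx P.
  rewrite invmxZ ?unitfE ?invr_eq0 // ?unitmxZ ?unitfE ?invr_eq0 //.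
  by rewrite invrK -!scalemxAl -!scalemxAr scalerA mulVf // scale1r.
by apply: SL_eq; rewrite -[LHS](mulmxK uP) ?eX ?eY -cj.
Qed.

Lemma word_trace_invariant (w : G -> G -> G) :
  (forall g x y : G, w (g * x * g^-1) (g * y * g^-1) = g * w x y * g^-1)%g ->
  conj_invariant (word_trace w).
Proof.
move=> wg g d; rewrite /word_trace /= wg slvalM mxtrace_mulC -slvalM.
by rewrite mulgA mulVg mul1g.
Qed.

Lemma cjgM (g x y : G) :
  ((g * x * g^-1) * (g * y * g^-1) = g * (x * y) * g^-1)%g.
Proof. by rewrite !mulgA (mulgVK). Qed.

Lemma cjgV (g x : G) : ((g * x * g^-1)^-1 = g * x^-1 * g^-1)%g.
Proof. by rewrite !invgM invgK !mulgA. Qed.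

Lemma t1_inv : conj_invariant t1.
Proof. by apply: word_trace_invariant => g x y; rewrite ?(cjgV, cjgM). Qed.
Lemma t2_inv : conj_invariant t2.
Proof. by apply: word_trace_invariant => g x y; rewrite ?(cjgV, cjgM). Qed.
Lemma u1_inv : conj_invariant u1.
Proof. by apply: word_trace_invariant => g x y; rewrite ?(cjgV, cjgM). Qed.
Lemma u2_inv : conj_invariant u2.
Proof. by apply: word_trace_invariant => g x y; rewrite ?(cjgV, cjgM). Qed.
Lemma u3_inv : conj_invariant u3.
Proof. by apply: word_trace_invariant => g x y; rewrite ?(cjgV, cjgM). Qed.
Lemma u4_inv : conj_invariant u4.
Proof. by apply: word_trace_invariant => g x y; rewrite ?(cjgV, cjgM). Qed.
Lemma u5_inv : conj_invariant u5.
Proof. by apply: word_trace_invariant => g x y; rewrite ?(cjgV, cjgM). Qed.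
Lemma u6_inv : conj_invariant u6.
Proof. by apply: word_trace_invariant => g x y; rewrite ?(cjgV, cjgM). Qed.
Lemma tc_inv : conj_invariant tc.
Proof. by apply: word_trace_invariant => g x y; rewrite ?(cjgV, cjgM). Qed.
Lemma tc'_inv : conj_invariant tc'.
Proof. by apply: word_trace_invariant => g x y; rewrite ?(cjgV, cjgM). Qed.

Lemma tanti_inv : conj_invariant tanti.
Proof. by move=> g d; rewrite /tanti tc_inv tc'_inv. Qed.

Lemma disc_inv : conj_invariant disc.
Proof. by move=> g d; rewrite /disc t1_inv t2_inv. Qed.

Lemma regular_mxX : regular_mx (fun d => mxX d).
Proof. by move=> i j; apply: regular_X. Qed.
Lemma regular_mxY : regular_mx (fun d => mxY d).
Proof. by move=> i j; apply: regular_Y. Qed.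

Lemma tc_regular : regular_function tc.
Proof.
apply: regular_ext (fun d => esym (tcE d)) _; apply: regular_tr.
have rX := regular_mxX; have rY := regular_mxY.
by do !apply: regular_mxM => //; apply: regular_adj3.
Qed.
Lemma tc'_regular : regular_function tc'.
Proof.
apply: regular_ext (fun d => esym (tc'E d)) _; apply: regular_tr.
have rX := regular_mxX; have rY := regular_mxY.
by do !apply: regular_mxM => //; apply: regular_adj3.
Qed.

Lemma subalg_disc (S : set (G * G -> C)) : subalgebra S -> S t1 -> S t2 -> S disc.
Proof.
move=> A h1 h2; have c := subalg_const A; rewrite /disc /delta.
apply: (subalgB A) => //; apply: (subalgD A); last first.
  by do 2?apply: (subalgM A).
apply: (subalgB A); last by apply: (subalgM A) => //; apply: (subalgX A).
apply: (subalgB A); last by apply: (subalgM A) => //; apply: (subalgX A).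
by apply: (subalgM A); apply: (subalgX A).
Qed.

Lemma trace_alg_disc : trace_alg disc.
Proof. exact: subalg_disc trace_alg_subalg trace_alg_t1 trace_alg_t2. Qed.

(** ** The eigenvalues *)

(** The diagonal entries of x_1, its eigenvalues when x_1 is triangular. *)
Definition xs d : 'I_3 -> C := fun i => mxX d i i.

Definition vand d : C :=
  (xs d i0 - xs d i1) * (xs d i0 - xs d i2) * (xs d i1 - xs d i2).

Lemma trig_xs d : is_trig_mx (mxX d) ->
  [/\ xs d i0 * xs d i1 * xs d i2 = 1, t1 d = xs d i0 + xs d i1 + xs d i2
    & t2 d = xs d i0 * xs d i1 + xs d i1 * xs d i2 + xs d i2 * xs d i0].
Proof.
move=> /is_trig_mxP tr; have U01 : mxX d i0 i1 = 0 by apply: tr.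
have U02 : mxX d i0 i2 = 0 by apply: tr.
have U12 : mxX d i1 i2 = 0 by apply: tr.
split.
- by rewrite -(detX d) det_mx33 /det3 U01 U02 U12 /xs; ring.
- by rewrite t1E tr3.
- by rewrite t2E tr3 !mxE /= U01 U02 U12 /xs; ring.
Qed.

Lemma disc_trig d : is_trig_mx (mxX d) -> disc d = vand d ^+ 2.
Proof. by move=> /trig_xs[e3 e1 e2]; rewrite /disc e1 e2 delta_factor. Qed.

End Traces.

(** * The discriminant locus *)

Section DiscriminantLocus.
Variable C : numClosedFieldType.
Local Notation G := (SL C 3).
Implicit Types (d : G * G) (f b e q : G * G -> C) (v : 'I_7 -> C).

Lemma trigonalization n (A : 'M[C]_n) :
  exists2 P, P \in unitmx & is_trig_mx (P *m A *m invmx P).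
Proof.
have [|P uP] := @cotrigonalization _ _ [:: A].
  by move=> B B'; rewrite !inE => /eqP -> /eqP ->.
rewrite /= andbT => trA; have {}uP := unitarymx_unit uP.
by exists P => //; rewrite /similar_to /= conjumx // in trA.
Qed.

(** Every pair is the end of a rational curve leaving the locus disc = 0:
    in a triangular form of x_1, scale the first two columns by w and 1/w. *)
Lemma disc_cancel f : regular_function f ->
  (forall d, disc d != 0 -> f d = 0) -> forall d, f d = 0.
Proof.
move=> [p pE] fv d.
have [P uP tr_U] := trigonalization (mxX d).
have [U UE] : exists U, U = P *m mxX d *m invmx P by eexists.
rewrite -UE in tr_U.
have U01 : U i0 i1 = 0 by apply: (is_trig_mxP tr_U).
have U02 : U i0 i2 = 0 by apply: (is_trig_mxP tr_U).
have U12 : U i1 i2 = 0 by apply: (is_trig_mxP tr_U).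
have dU : \det U = 1.
  by rewrite UE !det_mulmx detX mulr1 det_inv mulrV // -unitmxE.
set a := U i0 i0; set b := U i1 i1; set c := U i2 i2.
have abc : a * b * c = 1.
  by rewrite -dU det_mx33 /det3 U01 U02 U12 -/a -/b -/c; ring.
have [[b0 c0] a0] : (b != 0 /\ c != 0) /\ a != 0.
  by split; [split|]; apply: contraTneq (oner_neq0 C) => z0;
    rewrite negbK -abc z0 ?mulr0 ?mul0r.
pose D (w : C) := mx3 w 0 0 0 w^-1 0 0 0 1.
pose Xw w := invmx P *m (U *m D w) *m P.
pose g w := p.@[row_mx (mxvec (Xw w)) (mxvec (mxY d)) 0].
have D1 : D 1 = 1%:M.
  by apply: mx3P; rewrite !mxE /= ?invr1.
have g1 : g 1 = f d.
  by rewrite /g /Xw D1 mulmx1 UE !mulmxA mulVmx // mul1mx -mulmxA mulVmx // mulmx1 pE.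
have detD w : w != 0 -> \det (D w) = 1.
  by move=> w0; rewrite det_mx33 /det3 !mxE /=; field.
rewrite -g1.
pose h : {poly C} := (a *: 'X^2 - b%:P) * (a *: 'X - c%:P) * (b%:P - c *: 'X).
have hE w : h.[w] = (a * w ^+ 2 - b) * (a * w - c) * (b - c * w).
  by rewrite /h !(hornerM, hornerD, hornerN, hornerZ, hornerXn, hornerX, hornerC).
apply: (@laurent_vanish _ g h).
- have lD i j : laurent (fun w => D w i j).
    have l0 := laurent_const (0 : C); have l1 := laurent_const (1 : C).
    by move: i j; do 2!apply: ord3P;
      apply: (@laurent_ext _ (fun w => _)) => [w|]; rewrite ?mxE //=;
      first [exact: laurent_id | exact: laurent_inv | done].
  have lM (A : C -> 'M[C]_3) (B : 'M[C]_3) i j :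
      (forall i j, laurent (fun w => A w i j)) ->
      laurent (fun w => (A w *m B) i j).
    move=> lA; apply: (@laurent_ext _ (fun w =>
      A w i i0 * B i0 j + A w i i1 * B i1 j + A w i i2 * B i2 j)).
      by move=> w; rewrite mxE big_ord3.
    by apply: laurentD; first apply: laurentD; apply: laurentM => //;
      exact: laurent_const.
  have lMl (A : C -> 'M[C]_3) (B : 'M[C]_3) i j :
      (forall i j, laurent (fun w => A w i j)) ->
      laurent (fun w => (B *m A w) i j).
    move=> lA; apply: (@laurent_ext _ (fun w =>
      B i i0 * A w i0 j + B i i1 * A w i1 j + B i i2 * A w i2 j)).
      by move=> w; rewrite mxE big_ord3.
    by apply: laurentD; first apply: laurentD; apply: laurentM => //;
      exact: laurent_const.
  apply: (@laurent_meval _ _ p (fun k w => row_mx (mxvec (Xw w)) (mxvec (mxY d)) 0 k)).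
  move=> k; case: (split_ordP k) => l ->{k}; case/mxvec_indexP: l => i j.
    apply: (@laurent_ext _ (fun w => Xw w i j)).
      by move=> w; rewrite row_mxEl mxvecE.
    apply: (lM (fun w => invmx P *m (U *m D w))) => i' j'.
    apply: (lMl (fun w => U *m D w)) => i'' j''.
    exact: (lMl D).
  apply: laurent_ext (laurent_const (mxY d i j)) => w.
  by rewrite row_mxEr mxvecE.
- suff : h.[0] != 0 by apply: contraNneq => ->; rewrite horner0.
  by rewrite hE expr0n !mulr0 !sub0r subr0 !mulf_neq0 // oppr_eq0.
move=> w w0 hw.
have dX : \det (Xw w) = 1.
  rewrite /Xw !det_mulmx dU mul1r detD // mulr1 det_inv mulVr // -unitmxE //.
have [d1 [X1 Y1]] := ex_pair dX (detY d).
have dX2 : \det (U *m D w) = 1 by rewrite det_mulmx dU detD // mulr1.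
have dY2 : \det (P *m mxY d *m invmx P) = 1.
  by rewrite !det_mulmx detY mulr1 det_inv mulrV // -unitmxE.
have [d2 [X2 Y2]] := ex_pair dX2 dY2.
have d12 : conjugate d1 d2.
  exists P => //; rewrite X1 Y1 X2 Y2; split=> //.
    by rewrite /Xw !mulmxA mulmxV // mul1mx.
  by rewrite -!mulmxA mulVmx // mulmx1.
rewrite /g -X1 -Y1 -pE; apply: fv.
rewrite -(invariant_conjugate (@disc_inv C) d12) disc_trig; last first.
  rewrite X2; apply/is_trig_mxP; apply: ord3P; apply: ord3P => //= _;
    by rewrite !mxE big_ord3 !mxE /= ?U01 ?U02 ?U12; ring.
have -> : vand d2 = (a * w - b * w^-1) * (a * w - c) * (b * w^-1 - c).
  by rewrite /vand /xs X2 !mxE !big_ord3 !mxE /= -/a -/b -/c U01 U02 U12; ring.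
rewrite expf_neq0 //; apply: contraNneq hw => e0; rewrite hE.
have -> : (a * w ^+ 2 - b) * (a * w - c) * (b - c * w) =
  w ^+ 2 * ((a * w - b * w^-1) * (a * w - c) * (b * w^-1 - c)) by field.
by rewrite e0 mulr0.
Qed.

(** ** Transposition *)

Lemma SL_tr_subproof (g : G) : \det (slval g)^T == 1.
Proof. by rewrite det_tr; apply: slvalP. Qed.

Definition transpose d : G * G :=
  (SLMatrix (SL_tr_subproof d.1), SLMatrix (SL_tr_subproof d.2)).

Lemma transposeX d : mxX (transpose d) = (mxX d)^T. Proof. by []. Qed.
Lemma transposeY d : mxY (transpose d) = (mxY d)^T. Proof. by []. Qed.

Lemma adj3_tr (A : 'M[C]_3) : adj3 A^T = (adj3 A)^T.
Proof. by apply: mx3P; rewrite !mxE /= ?mxE; ring. Qed.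

Lemma tr_mulmx_tr (A B : 'M[C]_3) : \tr (A^T *m B^T) = \tr (A *m B).
Proof. by rewrite -trmx_mul mxtrace_tr mxtrace_mulC. Qed.

Lemma t2_transpose d : t2 (transpose d) = t2 d.
Proof. by rewrite !t2E transposeX adj3_tr mxtrace_tr. Qed.

Lemma coords_transpose d : coords (transpose d) =1 coords d.
Proof.
move=> i; rewrite /coords !(t1E, u1E, u2E, u3E, u4E, u5E, u6E).
by rewrite transposeX transposeY !adj3_tr !tr_mulmx_tr !mxtrace_tr.
Qed.

Lemma trace_alg_transpose b : trace_alg b -> forall d, b (transpose d) = b d.
Proof.
move=> [P PE] d; rewrite !PE /trace_poly /eval8 t2_transpose.
exact/meval_eq/coords_transpose.
Qed.

Lemma tc_transpose d : tc (transpose d) = tc' d.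
Proof.
rewrite tcE tc'E transposeX transposeY !adj3_tr -!trmx_mul mxtrace_tr.
by rewrite mxtrace_mulC.
Qed.

Lemma tc'_transpose d : tc' (transpose d) = tc d.
Proof.
rewrite tcE tc'E transposeX transposeY !adj3_tr -!trmx_mul mxtrace_tr.
by rewrite mxtrace_mulC.
Qed.

Lemma tanti_transpose d : tanti (transpose d) = - tanti d.
Proof. by rewrite /tanti tc_transpose tc'_transpose opprB. Qed.

(** ** A slice of the locus disc = 0 *)

(** The matrix with eigenvalues r, r, r^-2 and a nontrivial Jordan block. *)
Definition jordan (r : C) : 'M[C]_3 := mx3 r 1 0 0 r 0 0 0 (r^-1 ^+ 2).

Lemma det_jordan r : r != 0 -> \det (jordan r) = 1.
Proof. by move=> r0; rewrite det_mx3; field. Qed.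

Lemma jordan_t1 d r : mxX d = jordan r -> t1 d = dbl1 r.
Proof. by move=> X; rewrite t1E X tr_mx3 /dbl1; ring. Qed.

Lemma jordan_t2 d r : r != 0 -> mxX d = jordan r -> t2 d = dbl2 r.
Proof. by move=> r0 X; rewrite t2E X adj3_mx3 tr_mx3 /dbl2; field. Qed.

Lemma quadratic_root (x y z : C) : x != 0 ->
  exists w, x * w ^+ 2 + y * w + z = 0.
Proof.
move=> x0; have n2 := nat_neq0 C 1.
pose s := Num.Theory.nthroot 2 (y ^+ 2 - 4%:R * x * z).
have s2 : s ^+ 2 = y ^+ 2 - 4%:R * x * z by apply: Num.Theory.rootCK.
exists ((- y + s) / (2%:R * x)).
apply: (lincomb1 (k := (4%:R * x)^-1) _ s2); field.
by rewrite x0.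
Qed.

(** Almost all values of the last six traces are attained over such a matrix.
    The traces of y, x y, x^-1 y amount to a = y_11 + y_22, b = y_21, c = y_33,
    and those of y^-1, x y^-1, x^-1 y^-1 to the same expressions a', b', c' in
    the entries of y^-1. *)
Lemma jordan_slice r : r != 0 -> r ^+ 3 != 1 ->
  exists h : {mpoly C[7]},
    (exists2 v, v ord0 = dbl1 r & h.@[v] != 0) /\
    (forall v, v ord0 = dbl1 r -> h.@[v] != 0 ->
       exists d, [/\ coords d =1 v, mxX d = jordan r & t2 d = dbl2 r]).
Proof.
move=> r0 r3; pose s := r^-1 ^+ 2.
have sr : s - r != 0.
  apply: contraNneq r3 => /subr0_eq sr; rewrite exprSr -{2}sr /s.
  by apply/eqP; field.
have s0 : s != 0 by rewrite expf_neq0 // invr_eq0.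
have rs : r ^+ 2 * s = 1 by rewrite /s; field.
pose k := s / (s - r) ^+ 2.
pose c_ (x y z : C) := k * (y + r ^+ 2 * z - 2%:R * r * x).
pose b_ (x y z : C) := y - r * (x - c_ x y z) - s * c_ x y z.
pose cp (x y z : {mpoly C[7]}) :=
  k%:MP * (y + (r ^+ 2)%:MP * z - (2%:R * r)%:MP * x).
pose bp (x y z : {mpoly C[7]}) := y - r%:MP * (x - cp x y z) - s%:MP * cp x y z.
pose X_ j (lj : (j < 7)%N) : {mpoly C[7]} := 'X_(Ordinal lj).
pose x1 := @X_ 1%N isT; pose x2 := @X_ 2%N isT; pose x3 := @X_ 3%N isT.
pose x4 := @X_ 4%N isT; pose x5 := @X_ 5%N isT; pose x6 := @X_ 6%N isT.
pose h := bp x1 x2 x3 * (bp x4 x5 x6 + bp x1 x2 x3 * cp x1 x2 x3).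
pose V v j (lj : (j < 7)%N) : C := v (Ordinal lj).
have hE v : h.@[v] =
  let b := b_ (V v 1%N isT) (V v 2%N isT) (V v 3%N isT) in
  let c := c_ (V v 1%N isT) (V v 2%N isT) (V v 3%N isT) in
  let b' := b_ (V v 4%N isT) (V v 5%N isT) (V v 6%N isT) in
  b * (b' + b * c).
  rewrite /h /bp /cp /= !(mevalD, mevalM, mevalN) /x1 /x2 /x3 /x4 /x5 /x6 /X_.
  by rewrite !(mevalXU, mevalC).
have lin x y z : let c := c_ x y z in let b := b_ x y z in let a := x - c in
   [/\ a + c = x, r * a + b + s * c = y & r^-1 * a - s * b + r ^+ 2 * c = z].
  split; rewrite /b_; [ring|ring|].
  rewrite /c_ /k /s; field; rewrite r0 /=.
  apply: contraNneq sr => h0; rewrite /s.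
  by apply/eqP; apply: (lincomb1 (k := (r ^+ 2)^-1) _ h0); field.
exists h; split.
  (* these values correspond to a = c = 0, b = 1 and a' = c' = 0, b' = 1 *)
  exists (fun i => [:: dbl1 r; 0; 1; - s; 0; 1; - s]`_i) => //.
  rewrite hE /V /= .
  have c0 : c_ 0 1 (- s) = 0 by rewrite /c_ mulrN rs mulr0 subr0 subrr mulr0.
  have b1 : b_ 0 1 (- s) = 1 by rewrite /b_ c0 subr0 !mulr0 !subr0.
  by rewrite c0 b1 mulr0 addr0 mulr1 oner_neq0.
move=> v v0; rewrite hE /=.
set y1 := V v 1%N isT; set y2 := V v 2%N isT; set y3 := V v 3%N isT.
set y4 := V v 4%N isT; set y5 := V v 5%N isT; set y6 := V v 6%N isT.
have := lin y1 y2 y3; have := lin y4 y5 y6; rewrite /=.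
set b := b_ y1 y2 y3; set c := c_ y1 y2 y3.
set b' := b_ y4 y5 y6; set c' := c_ y4 y5 y6.
set a := y1 - c; set a' := y4 - c'.
clearbody a a' b b' c c'; move=> [A1 A2 A3] [B1 B2 B3].
set m := b' + b * c; set n := a * c - a'.
rewrite mulf_eq0 negb_or => /andP[b0 m0].
(* y is sought with y_11 = 0 and y_23 = 1; t is its entry y_13 *)
have [t tE] := @quadratic_root (b * m) (m * a - b * n)
  (1 - c * c' + m * c' / b) (mulf_neq0 b0 m0).
pose Y := mx3 0 (- c' / b) t b a 1 m (n - m * t) c.
have dY : \det Y = 1.
  by rewrite det_mx3; apply: (lincomb1 (k := - 1) _ tE); field.
have [d [dX dY']] := ex_pair (det_jordan r0) dY.
exists d; split=> //; last exact: jordan_t2.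
have rsi : r * s = r^-1 by rewrite /s; field.
have rr : r * r = r ^+ 2 by rewrite expr2.
case=> [[|[|[|[|[|[|[|//]]]]]]] lti]; rewrite /coords /=.
- by rewrite (jordan_t1 dX) -v0; congr v; apply: val_inj.
- rewrite u1E dY' tr_mx3 add0r B1.
  by rewrite /y1 /V; congr v; apply: val_inj.
- rewrite u2E dX dY' mul_mx3 tr_mx3.
  transitivity y2; last by rewrite /y2 /V; congr v; apply: val_inj.
  by rewrite -B2 /s; ring.
- rewrite u3E dX dY' adj3_mx3 mul_mx3 tr_mx3 -/s.
  transitivity y3; last by rewrite /y3 /V; congr v; apply: val_inj.
  by rewrite -B3 -rsi; ring.
- rewrite u4E dY' adj3_mx3 tr_mx3.
  transitivity y4; last by rewrite /y4 /V; congr v; apply: val_inj.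
  by rewrite -A1 /n; field.
- rewrite u5E dX dY' adj3_mx3 mul_mx3 tr_mx3 -/s.
  transitivity y5; last by rewrite /y5 /V; congr v; apply: val_inj.
  by rewrite -A2 /n /m; field.
- rewrite u6E dX dY' !adj3_mx3 mul_mx3 tr_mx3 -/s.
  transitivity y6; last by rewrite /y6 /V; congr v; apply: val_inj.
  by rewrite -A3 -rsi /n /m; field.
Qed.

(** The antisymmetric part of the commutator trace does not vanish
    identically on the slice. *)
Lemma tanti_slice r : r != 0 -> r ^+ 3 != 1 ->
  exists d, [/\ t1 d = dbl1 r, t2 d = dbl2 r & tanti d != 0].
Proof.
move=> r0 r3; pose Y : 'M[C]_3 := mx3 0 2%:R 1 1 0 1 1 (-1) 0.
have dY : \det Y = 1 by rewrite det_mx3; ring.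
have [d [dX dY']] := ex_pair (det_jordan r0) dY.
exists d; split; [exact: jordan_t1 | exact: jordan_t2 |].
have -> : tanti d = - 2%:R * ((1 - r ^+ 3) / r ^+ 2) ^+ 2.
  rewrite /tanti tcE tc'E dX dY' /jordan /Y !(adj3_mx3, mul_mx3) !tr_mx3.
  by field.
rewrite mulf_neq0 ?oppr_eq0 ?nat_neq0 // expf_neq0 // mulf_neq0 //.
  by rewrite subr_eq0 eq_sym.
by rewrite invr_eq0 expf_neq0.
Qed.

(** If b e vanishes on the locus disc = 0, while e does not vanish identically
    over any given pair of distinct eigenvalues r, r^-2, then disc divides b. *)
Lemma trace_alg_dvd b e : trace_alg b -> trace_alg e ->
  (forall r, r != 0 -> r ^+ 3 != 1 ->
     exists d, [/\ t1 d = dbl1 r, t2 d = dbl2 r & e d != 0]) ->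
  (forall d, disc d = 0 -> b d * e d = 0) ->
  exists2 q, trace_alg q & forall d, b d = disc d * q d.
Proof.
move=> [P PE] [P' P'E] enz bv.
have [|Q QE] := @delta_dvd C P; last first.
  exists (trace_poly Q); first by exists Q.
  by move=> d; rewrite PE /trace_poly QE.
move=> r v r0 r3; move: v.
have [d0 [dr1 dr2 ed0]] := enz r r0 r3.
apply: (@meval_domain _ _ ord0 _ _ P'.[(dbl2 r)%:MP]); last first.
  by exists (coords d0) => //; rewrite P'E /trace_poly dr2 in ed0.
have [h [hnz hd]] := jordan_slice r0 r3.
move=> v v0 P'v; suff : (P.[(dbl2 r)%:MP] * P'.[(dbl2 r)%:MP]).@[v] = 0.
  by move=> /eqP; rewrite mevalM mulf_eq0 (negPf P'v) orbF => /eqP.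
move: v v0 {P'v}; apply: (@meval_domain _ _ ord0 _ _ h) => // v v0 hv.
have [d [dv dX d2]] := hd v v0 hv.
have := bv d; rewrite PE P'E /disc d2 (jordan_t1 dX) delta_dbl // => /(_ erefl).
rewrite /trace_poly /eval8 d2 mevalM => E0.
by rewrite -(meval_eq _ dv) -(meval_eq P'.[_] dv).
Qed.

Lemma trace_alg_dvd1 b : trace_alg b -> (forall d, disc d = 0 -> b d = 0) ->
  exists2 q, trace_alg q & forall d, b d = disc d * q d.
Proof.
move=> ab bv; apply: (trace_alg_dvd ab (subalg_const (trace_alg_subalg C) 1)).
  move=> r r0 r3; have [d [? ? _]] := tanti_slice r0 r3.
  by exists d; rewrite oner_neq0.
by move=> d /bv ->; rewrite mul0r.
Qed.

End DiscriminantLocus.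

(** * Pairs whose first matrix is diagonal *)

Section DiagonalPairs.
Variable C : numClosedFieldType.
Local Notation G := (SL C 3).
Implicit Types (d : G * G) (f g : G * G -> C).

Lemma ex_conjugate (P X Y : 'M[C]_3) d : P \in unitmx ->
  X *m P = P *m mxX d -> Y *m P = P *m mxY d ->
  exists d', [/\ conjugate d d', mxX d' = X & mxY d' = Y].
Proof.
move=> uP XP YP.
have P0 : \det P != 0 by rewrite -unitfE -unitmxE.
have dX : \det X = 1.
  by apply: (mulIf P0); rewrite -det_mulmx XP det_mulmx detX mulr1 mul1r.
have dY : \det Y = 1.
  by apply: (mulIf P0); rewrite -det_mulmx YP det_mulmx detY mulr1 mul1r.
have [d' [X' Y']] := ex_pair dX dY.
by exists d'; split=> //; exists P; rewrite // X' Y'.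
Qed.

Lemma conjugate_trans d1 d2 d3 :
  conjugate d1 d2 -> conjugate d2 d3 -> conjugate d1 d3.
Proof.
move=> [P uP [PX PY]] [Q uQ [QX QY]]; exists (Q *m P).
  by rewrite unitmx_mul uQ.
by rewrite !mulmxA QX QY -!mulmxA PX PY.
Qed.

Lemma conjugate_trig d : exists2 d', conjugate d d' & is_trig_mx (mxX d').
Proof.
have [P uP trU] := trigonalization (mxX d).
have [d' [c X' Y']] := ex_conjugate uP (mulmxKV uP (P *m mxX d))
  (mulmxKV uP (P *m mxY d)).
by exists d'; rewrite // X'.
Qed.

Lemma conjugate_diag d : disc d != 0 ->
  exists2 d', conjugate d d' & is_diag_mx (mxX d').
Proof.
move=> dd; have [d1 c1 tr1] := conjugate_trig d.
have : disc d1 != 0 by rewrite (invariant_conjugate (@disc_inv C) c1).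
rewrite disc_trig // /vand expf_eq0 /= !mulf_eq0 !negb_or !subr_eq0.
case/andP=> /andP[n01 n02] n12.
have [P uP] : diagonalizable (mxX d1).
  apply/diagonalizableP; exists [:: xs d1 i0; xs d1 i1; xs d1 i2].
    by rewrite /= !inE negb_or n01 n02 n12.
  rewrite !big_cons big_nil mulr1 mulrA.
  have := mxminpoly_dvd_char (mxX d1).
  by rewrite char_poly_trig // big_ord3.
rewrite /similar_to /= conjumx // => dU.
have [d' [c X' Y']] := ex_conjugate uP (mulmxKV uP (P *m mxX d1))
  (mulmxKV uP (P *m mxY d1)).
by exists d'; [exact: conjugate_trans c1 c | rewrite X'].
Qed.

Lemma diagX d : is_diag_mx (mxX d) ->
  mxX d = mx3 (xs d i0) 0 0 0 (xs d i1) 0 0 0 (xs d i2).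
Proof. by move/is_diag_mxP=> D; apply: mx3P; rewrite !mxE //= D. Qed.

(** Conjugation by a permutation matrix permutes the diagonal entries. *)
Lemma conjugate_perm d (s : 'S_3) : is_diag_mx (mxX d) ->
  exists d', [/\ conjugate d d', is_diag_mx (mxX d')
    & forall i, xs d' i = xs d (s i)].
Proof.
move=> /is_diag_mxP D; pose A' (A : 'M[C]_3) := \matrix_(i, j) A (s i) (s j).
have AP A : A' A *m perm_mx s = perm_mx s *m A.
  rewrite -row_permE -[X in _ *m perm_mx X](invgK s) -col_permE.
  by apply/matrixP => i j; rewrite !mxE permKV.
have [d' [c X' Y']] := ex_conjugate (unitmx_perm _ s) (AP (mxX d)) (AP (mxY d)).
exists d'; split=> //; last by move=> i; rewrite /xs X' mxE.
apply/is_diag_mxP => i j nij; rewrite X' mxE D //.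
by apply: contra_neq nij => /ord_inj/perm_inj ->.
Qed.

(** Conjugation by a diagonal matrix fixes a diagonal x_1. *)
Lemma conjugate_torus d (t : 'I_3 -> C) : is_diag_mx (mxX d) ->
  (forall i, t i != 0) ->
  exists d', [/\ conjugate d d', mxX d' = mxX d
    & forall i j, mxY d' i j = t i / t j * mxY d i j].
Proof.
move=> /is_diag_mxP D t0; pose P := diag_mx (\row_i t i).
have uP : P \in unitmx.
  by rewrite unitmxE det_diag unitfE prodf_seq_neq0; apply/allP => i _; rewrite mxE t0.
pose Y := \matrix_(i, j) (t i / t j * mxY d i j).
have XP : mxX d *m P = P *m mxX d.
  rewrite mul_mx_diag mul_diag_mx; apply/matrixP => i j; rewrite !mxE.
  have [->|nij] := eqVneq i j; first by rewrite mulrC.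
  by rewrite D ?mul0r ?mulr0.
have YP : Y *m P = P *m mxY d.
  rewrite mul_mx_diag mul_diag_mx; apply/matrixP => i j; rewrite !mxE.
  by field.
have [d' [c X' Y']] := ex_conjugate uP XP YP.
by exists d'; split=> // i j; rewrite Y' mxE.
Qed.

(** ** Symmetrization *)

Section Span.
Variable S : set (G * G -> C).
Hypothesis algS : subalgebra S.

(** Over the pairs with x_1 diagonal, the combinations of elements of S whose
    coefficients are polynomials in the diagonal entries of x_1. *)
Definition eigenspan g := exists (I : finType) (m : I -> {mpoly C[3]})
    (b : I -> G * G -> C), (forall i, S (b i)) /\
  forall d, is_diag_mx (mxX d) -> g d = \sum_i (m i).@[xs d] * b i d.

Lemma eigenspan_poly (m : {mpoly C[3]}) : eigenspan (fun d => m.@[xs d]).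
Proof.
exists unit, (fun=> m), (fun=> fun=> 1); split=> [_|d _].
  exact: subalg_const.
by rewrite (big_pred1 tt) ?mulr1 // => -[].
Qed.

Lemma eigenspan_in g : S g -> eigenspan g.
Proof.
move=> Sg; exists unit, (fun=> 1), (fun=> g); split=> // d _.
by rewrite (big_pred1 tt) ?meval1 ?mul1r // => -[].
Qed.

Lemma eigenspanM f g : eigenspan f -> eigenspan g ->
  eigenspan (fun d => f d * g d).
Proof.
move=> [I [m [b [Sb fE]]]] [J [n [c [Sc gE]]]].
exists (I * J)%type, (fun p => m p.1 * n p.2), (fun p d => b p.1 d * c p.2 d).
split=> [p|d D]; first exact: subalgM.
rewrite fE // gE // big_distrlr pair_big /=; apply: eq_bigr => p _.
by rewrite mevalM; ring.
Qed.

Lemma eigenspanD f g : eigenspan f -> eigenspan g ->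
  eigenspan (fun d => f d + g d).
Proof.
move=> [I [m [b [Sb fE]]]] [J [n [c [Sc gE]]]].
exists (I + J)%type,
  (fun p => match p with inl i => m i | inr j => n j end),
  (fun p => match p with inl i => b i | inr j => c j end).
split=> [[i|j] //|d D]; by rewrite big_sumType fE // gE.
Qed.

Lemma eigenspan_subalg : subalgebra eigenspan.
Proof.
split=> [|a f g Sf Sg|]; last exact: eigenspanM.
  exact: (eigenspan_in (subalg_const algS 1)).
apply: eigenspanD => //; apply: eigenspanM => //.
exact: (eigenspan_in (subalg_const algS a)).
Qed.

(** The localization of eigenspan at the Vandermonde product of the
    eigenvalues of x_1. *)
Definition locspan g := exists k, eigenspan (fun d => vand d ^+ k * g d).

Lemma eigenspan_xs i : eigenspan (fun d => xs d i).
Proof.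
have := eigenspan_poly 'X_i; apply: subalg_ext => d.
by rewrite mevalXU.
Qed.

Lemma eigenspan_vand k : eigenspan (fun d => vand d ^+ k).
Proof.
apply: (subalgX eigenspan_subalg); have A := eigenspan_subalg.
by apply: (subalgM A); first apply: (subalgM A);
  apply: (subalgB A); apply: eigenspan_xs.
Qed.

Lemma locspan_eigenspan g : eigenspan g -> locspan g.
Proof. by move=> Sg; exists 0%N; apply: subalg_ext Sg => d; rewrite mul1r. Qed.

Lemma locspan_subalg : subalgebra locspan.
Proof.
have A := eigenspan_subalg.
split=> [|a f g [k Sf] [l Sg]|f g [k Sf] [l Sg]].
- exact: (locspan_eigenspan (subalg_const A 1)).
- exists (k + l)%N; apply: (@subalg_ext _ _ _ (fun d =>
    vand d ^+ l * (a * (vand d ^+ k * f d)) + vand d ^+ k * (vand d ^+ l * g d))).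
    by move=> d; rewrite exprD; ring.
  apply: (subalgD A); apply: (subalgM A) => //; try exact: eigenspan_vand.
  by apply: (subalgM A) => //; apply: subalg_const.
- exists (k + l)%N; apply: (@subalg_ext _ _ _ (fun d =>
    (vand d ^+ k * f d) * (vand d ^+ l * g d))).
    by move=> d; rewrite exprD; ring.
  exact: (subalgM A).
Qed.

Lemma locspan_diag f g : (forall d, is_diag_mx (mxX d) -> f d = g d) ->
  locspan f -> locspan g.
Proof.
move=> fg [k [I [m [b [Sb fE]]]]]; exists k, I, m, b; split=> // d D.
by rewrite -fE // fg.
Qed.

Lemma locspan_vand g : locspan (fun d => vand d * g d) -> locspan g.
Proof.
move=> [k Sg]; exists k.+1; apply: subalg_ext Sg => d.
by rewrite exprSr mulrA.
Qed.

Hypothesis S_inv : forall g, S g -> conj_invariant g.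
Hypothesis S_t1 : S (@t1 C).
Hypothesis S_t2 : S (@t2 C).

(** A symmetric polynomial in the eigenvalues of x_1 is a polynomial in the
    traces of x_1 and of its inverse. *)
Lemma symmetric_xs (p : {mpoly C[3]}) : p \is symmetric ->
  exists2 a, S a & forall d, is_diag_mx (mxX d) -> p.@[xs d] = a d.
Proof.
move=> /sym_fundamental[q [<- _]].
pose w d : 'I_3 -> C := fun i => nth 0 [:: t1 d; t2 d; 1] i.
exists (fun d => q.@[w d]).
  apply: (subalg_meval algS); case=> [[|[|[|//]]] lti] //.
  exact: subalg_const.
move=> d D; rewrite comp_mpoly_meval; apply: meval_eq => i.
have [e3 e1 e2] := trig_xs (is_diag_mx_is_trig D).
rewrite tnth_mktuple /w; move: i; apply: ord3P => /=.
- by rewrite mesym1E big_ord3 !mevalD !mevalXU e1.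
- have := mroots_coeff [tuple xs d i | i < 3] (@Ordinal 4 2 isT).
  rewrite (meval_eq (v2 := xs d)) => [/=|j]; last by rewrite tnth_mktuple.
  rewrite expr2 mulrNN !mul1r => <-; rewrite big_map big_enum /= big_ord3.
  rewrite -[LHS]mulr1n -coef_deriv -horner_coef0 !(derivM, derivB, derivX, derivC).
  rewrite !(hornerD, hornerM, hornerN, hornerX, hornerC) e2; ring.
- by rewrite mesymnnE big_ord3 !mevalM !mevalXU e3.
Qed.

Lemma meval_msym (s : 'S_3) (p : {mpoly C[3]}) v :
  (msym s p).@[v] = p.@[fun i => v (s i)].
Proof.
rewrite /msym /mmap raddf_sum mevalE; apply: eq_bigr => m _ /=.
rewrite mevalM mevalC; congr (_ * _).
rewrite /mmap1 rmorph_prod; apply: eq_bigr => i _ /=.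
by rewrite rmorphXn /= mevalXU.
Qed.

(** Averaging over the permutations of the eigenvalues removes them from the
    coefficients. *)
Lemma locspan_invariant f : conj_invariant f -> locspan f ->
  exists k, exists2 a, S a & forall d, disc d ^+ k * f d = a d.
Proof.
move=> fi [k [I [m [b [Sb fE]]]]].
pose vd : {mpoly C[3]} := ('X_i0 - 'X_i1) * ('X_i0 - 'X_i2) * ('X_i1 - 'X_i2).
have vdE d : vd.@[xs d] = vand d by rewrite !(mevalM, mevalB) !mevalXU.
pose M i := \sum_(s : 'S_3) msym s (vd ^+ k * m i).
have symM i : M i \is symmetric.
  apply/issymP => s; rewrite /M raddf_sum /=.
  rewrite [RHS](reindex_inj (mulIg s)) /=.
  by apply: eq_bigr => s' _; rewrite msymMm.
have [a aP] := choice (fun i =>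
  let: ex_intro2 a Sa aE := symmetric_xs (symM i) in ex_intro _ a (conj Sa aE)).
have n0 : #|{: 'S_3}|%:R != 0 :> C.
  by rewrite Num.Theory.pnatr_eq0 -lt0n; apply/card_gt0P; exists 1%g.
pose g d := #|{: 'S_3}|%:R^-1 * \sum_i a i d * b i d.
have Sg : S g.
  apply: (subalgM algS); first exact: subalg_const.
  apply: (subalg_sum algS) => i _; apply: (subalgM algS) => //.
  by have [] := aP i.
have gE d : is_diag_mx (mxX d) -> disc d ^+ k * f d = g d.
  move=> D; apply: (mulfI n0); rewrite /g mulVKf //.
  transitivity (\sum_(s : 'S_3) disc d ^+ k * f d).
    by rewrite sumr_const mulr_natl.
  transitivity (\sum_(s : 'S_3) \sum_i (vd ^+ k * m i).@[fun j => xs d (s j)] * b i d).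
    apply: eq_bigr => s _; have [d' [c D' xd']] := conjugate_perm s D.
    rewrite -(invariant_conjugate fi c) -(invariant_conjugate (@disc_inv C) c).
    rewrite disc_trig ?is_diag_mx_is_trig // -exprM mulnC exprM expr2.
    rewrite -mulrA fE // big_distrr /=; apply: eq_bigr => i _.
    rewrite (invariant_conjugate (S_inv (Sb i)) c) -(meval_eq _ xd').
    by rewrite mevalM rmorphXn /= vdE mulrA.
  rewrite exchange_big; apply: eq_bigr => i _.
  have [_ <-] := aP i => //; rewrite /M raddf_sum /= big_distrl /=.
  by apply: eq_bigr => s _; rewrite meval_msym.
exists k.+1, (fun d => disc d * g d).
  exact: (subalgM algS (subalg_disc algS S_t1 S_t2) Sg).
move=> d; have [->|dd] := eqVneq (disc d) 0; first by rewrite exprS !mul0r.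
have [d' c D'] := conjugate_diag dd.
rewrite exprS -mulrA; congr (_ * _).
rewrite -(invariant_conjugate fi c) -(invariant_conjugate (@disc_inv C) c).
by rewrite -(invariant_conjugate (S_inv Sg) c) gE.
Qed.

End Span.
End DiagonalPairs.

(** ** Torus invariants *)

Section TorusInvariants.
Variable C : numClosedFieldType.
Local Notation G := (SL C 3).
Implicit Types (d : G * G) (f g : G * G -> C).

Section Entries.
Variable S : set (G * G -> C).
Hypothesis algS : subalgebra S.

Let algE := eigenspan_subalg algS.
Let algL := locspan_subalg algS.

(** The Lagrange interpolation formulas recover the diagonal entries of a
    matrix from its products with 1, x_1 and the inverse of x_1. *)
Lemma locspan_diag_entry (A : G * G -> 'M[C]_3) :
  S (fun d => \tr (A d)) -> S (fun d => \tr (mxX d *m A d)) ->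
  S (fun d => \tr (adj3 (mxX d) *m A d)) ->
  forall i, locspan S (fun d => A d i i).
Proof.
have SE := @eigenspan_in C S; move=> /SE a1 /SE a2 /SE a3.
have x := eigenspan_xs algS.
have lagr (i j k : 'I_3) : locspan S (fun d => (xs d j - xs d k) * (xs d i *
    (\tr (mxX d *m A d) - (xs d j + xs d k) * \tr (A d)
     + xs d j * xs d k * \tr (adj3 (mxX d) *m A d)))).
  apply: locspan_eigenspan; apply: (subalgM algE); first exact: subalgB.
  apply: (subalgM algE) => //; apply: (subalgD algE).
    by apply: (subalgB algE) => //; apply: (subalgM algE) => //; apply: subalgD.
  by apply: (subalgM algE) => //; apply: subalgM.
have tr1 d : is_diag_mx (mxX d) -> \tr (mxX d *m A d) =
    xs d i0 * A d i0 i0 + xs d i1 * A d i1 i1 + xs d i2 * A d i2 i2.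
  by move=> D; rewrite tr3M (diagX D) !mxE /=; ring.
have tr2 d : is_diag_mx (mxX d) -> \tr (adj3 (mxX d) *m A d) =
    xs d i1 * xs d i2 * A d i0 i0 + xs d i0 * xs d i2 * A d i1 i1
    + xs d i0 * xs d i1 * A d i2 i2.
  by move=> D; rewrite tr3M (diagX D) adj3_mx3 !mxE /=; ring.
apply: ord3P; apply: locspan_vand.
- apply: locspan_diag (lagr i0 i1 i2) => d D.
  have [e3 _ _] := trig_xs (is_diag_mx_is_trig D); rewrite tr1 // tr2 // tr3 /vand.
  apply: (lincomb1 (k := (xs d i1 - xs d i2) * (xs d i1 * xs d i2 * A d i0 i0
    + xs d i0 * xs d i2 * A d i1 i1 + xs d i0 * xs d i1 * A d i2 i2)) _ e3).
  by ring.
- apply: locspan_diag (lagr i1 i2 i0) => d D.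
  have [e3 _ _] := trig_xs (is_diag_mx_is_trig D); rewrite tr1 // tr2 // tr3 /vand.
  apply: (lincomb1 (k := (xs d i2 - xs d i0) * (xs d i1 * xs d i2 * A d i0 i0
    + xs d i0 * xs d i2 * A d i1 i1 + xs d i0 * xs d i1 * A d i2 i2)) _ e3).
  by ring.
- apply: locspan_diag (lagr i2 i0 i1) => d D.
  have [e3 _ _] := trig_xs (is_diag_mx_is_trig D); rewrite tr1 // tr2 // tr3 /vand.
  apply: (lincomb1 (k := (xs d i0 - xs d i1) * (xs d i1 * xs d i2 * A d i0 i0
    + xs d i0 * xs d i2 * A d i1 i1 + xs d i0 * xs d i1 * A d i2 i2)) _ e3).
  by ring.
Qed.

Hypotheses (S_u1 : S (@u1 C)) (S_u2 : S (@u2 C)) (S_u3 : S (@u3 C))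
  (S_u4 : S (@u4 C)) (S_u5 : S (@u5 C)) (S_u6 : S (@u6 C)).

Lemma locspan_Y i : locspan S (fun d => mxY d i i).
Proof.
apply: (locspan_diag_entry (A := fun d => mxY d)).
- exact: subalg_ext (@u1E C) S_u1.
- exact: subalg_ext (@u2E C) S_u2.
- exact: subalg_ext (@u3E C) S_u3.
Qed.

Lemma locspan_adjY i : locspan S (fun d => adj3 (mxY d) i i).
Proof.
apply: (locspan_diag_entry (A := fun d => adj3 (mxY d))).
- exact: subalg_ext (@u4E C) S_u4.
- exact: subalg_ext (@u5E C) S_u5.
- exact: subalg_ext (@u6E C) S_u6.
Qed.

(** The products of the entries of x_2 along the cycles of length two. *)
Lemma locspan_cycle2 i j : i != j ->
  locspan S (fun d => mxY d i j * mxY d j i).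
Proof.
have L (k l m : 'I_3) : (forall d, mxY d k k * mxY d l l - adj3 (mxY d) m m =
    mxY d k l * mxY d l k) -> locspan S (fun d => mxY d k l * mxY d l k).
  move=> E; apply: subalg_ext E _; apply: (subalgB algL); last exact: locspan_adjY.
  by apply: (subalgM algL); apply: locspan_Y.
move: i j; apply: ord3P; apply: ord3P => //= _;
  [apply: (L _ _ i2) | apply: (L _ _ i1) | apply: (L _ _ i2) | apply: (L _ _ i0)
  | apply: (L _ _ i1) | apply: (L _ _ i0)] => d; rewrite !mxE /=; ring.
Qed.

(** The products of the entries of x_2 along the two cycles of length three. *)
Definition cyc d := mxY d i0 i1 * mxY d i1 i2 * mxY d i2 i0.
Definition cyc' d := mxY d i0 i2 * mxY d i2 i1 * mxY d i1 i0.

Lemma locspan_cyc_sum : locspan S (fun d => cyc d + cyc' d).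
Proof.
have Y := locspan_Y.
have c01 := @locspan_cycle2 i0 i1 isT; have c02 := @locspan_cycle2 i0 i2 isT.
have c12 := @locspan_cycle2 i1 i2 isT.
apply: (@subalg_ext _ _ _ (fun d => 1
   - mxY d i0 i0 * mxY d i1 i1 * mxY d i2 i2
   + mxY d i0 i0 * (mxY d i1 i2 * mxY d i2 i1)
   + mxY d i1 i1 * (mxY d i0 i2 * mxY d i2 i0)
   + mxY d i2 i2 * (mxY d i0 i1 * mxY d i1 i0))).
  by move=> d; rewrite -(detY d) det_mx33 /det3 /cyc /cyc'; ring.
do 3?[apply: (subalgD algL); last exact: subalgM].
apply: (subalgB algL); first exact: subalg_const.
by apply: (subalgM algL) => //; apply: subalgM.
Qed.

Lemma tanti_diag d : is_diag_mx (mxX d) ->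
  tanti d = vand d * (cyc' d - cyc d).
Proof.
move=> D; rewrite /tanti tcE tc'E /cyc /cyc'.
have YE : mxY d = mx3 (mxY d i0 i0) (mxY d i0 i1) (mxY d i0 i2)
  (mxY d i1 i0) (mxY d i1 i1) (mxY d i1 i2)
  (mxY d i2 i0) (mxY d i2 i1) (mxY d i2 i2) by apply: mx3P; rewrite !mxE.
move: (mxY d i0 i0) (mxY d i0 i1) (mxY d i0 i2) (mxY d i1 i0) (mxY d i1 i1)
  (mxY d i1 i2) (mxY d i2 i0) (mxY d i2 i1) (mxY d i2 i2) YE.
move=> y00 y01 y02 y10 y11 y12 y20 y21 y22 YE.
by rewrite YE (diagX D) !(adj3_mx3, mul_mx3) !tr_mx3 /vand; ring.
Qed.

Lemma locspan_tanti_sq : locspan S (fun d => tanti d ^+ 2).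
Proof.
apply: (@locspan_diag _ _ (fun d => vand d ^+ 2 * ((cyc d + cyc' d) ^+ 2 - 4%:R *
   ((mxY d i0 i1 * mxY d i1 i0) * (mxY d i0 i2 * mxY d i2 i0)
     * (mxY d i1 i2 * mxY d i2 i1))))).
  by move=> d D; rewrite tanti_diag // /cyc /cyc'; ring.
apply: (subalgM algL); first exact/locspan_eigenspan/eigenspan_vand.
apply: (subalgB algL); first exact/(subalgX algL)/locspan_cyc_sum.
apply: (subalgM algL); first exact: subalg_const.
by apply: (subalgM algL); first apply: (subalgM algL); exact: locspan_cycle2.
Qed.

Hypothesis S_tanti : S (@tanti C).

Lemma locspan_cyc_diff : locspan S (fun d => cyc' d - cyc d).
Proof.
apply: locspan_vand.
by apply: locspan_diag (@tanti_diag) _; exact/locspan_eigenspan/eigenspan_in.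
Qed.

Lemma locspan_cyc : locspan S cyc /\ locspan S cyc'.
Proof.
have n2 := nat_neq0 C 1.
have ls := locspan_cyc_sum; have ld := locspan_cyc_diff.
have h := subalg_const algL 2%:R^-1.
split.
  apply: subalg_ext (subalgM algL h (subalgB algL ls ld)) => d.
  by field.
apply: subalg_ext (subalgM algL h (subalgD algL ls ld)) => d.
by field.
Qed.

(** ** Monomials in the entries of x_2 *)

Definition monoY (B : 'I_3 -> 'I_3 -> nat) d : C :=
  \prod_i \prod_j mxY d i j ^+ B i j.
Definition rowdeg (B : 'I_3 -> 'I_3 -> nat) i := (\sum_j B i j)%N.
Definition coldeg (B : 'I_3 -> 'I_3 -> nat) j := (\sum_i B i j)%N.

(** A monomial of weight zero is a product of monomials along cycles. *)
Lemma locspan_monoY (B : 'I_3 -> 'I_3 -> nat) :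
  rowdeg B i0 = coldeg B i0 -> rowdeg B i1 = coldeg B i1 ->
  locspan S (monoY B).
Proof.
rewrite /rowdeg /coldeg !big_ord3 /= => e0 e1.
have Y i := subalgX algL (B i i) (locspan_Y i).
have [lc lc'] := locspan_cyc.
have c2 i j k (ij : i != j) := subalgX algL k (locspan_cycle2 ij).
have [le|/ltnW le] := leqP (B i1 i0) (B i0 i1).
  pose k := (B i0 i1 - B i1 i0)%N.
  have E01 : B i0 i1 = (B i1 i0 + k)%N by rewrite /k; lia.
  have E12 : B i1 i2 = (B i2 i1 + k)%N by rewrite /k; lia.
  have E20 : B i2 i0 = (B i0 i2 + k)%N by rewrite /k; lia.
  apply: (@subalg_ext _ _ _ (fun d =>
    mxY d i0 i0 ^+ B i0 i0 * mxY d i1 i1 ^+ B i1 i1 * mxY d i2 i2 ^+ B i2 i2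
    * (mxY d i0 i1 * mxY d i1 i0) ^+ B i1 i0
    * (mxY d i1 i2 * mxY d i2 i1) ^+ B i2 i1
    * (mxY d i0 i2 * mxY d i2 i0) ^+ B i0 i2 * cyc d ^+ k)).
    move=> d; rewrite /monoY !big_ord3 /= E01 E12 E20 /cyc !exprMn !exprD.
    by ring.
  by do 6![apply: (subalgM algL); last by [apply: c2 | apply: subalgX | ]].
pose k := (B i1 i0 - B i0 i1)%N.
have E01 : B i1 i0 = (B i0 i1 + k)%N by rewrite /k; lia.
have E12 : B i2 i1 = (B i1 i2 + k)%N by rewrite /k; lia.
have E20 : B i0 i2 = (B i2 i0 + k)%N by rewrite /k; lia.
apply: (@subalg_ext _ _ _ (fun d =>
  mxY d i0 i0 ^+ B i0 i0 * mxY d i1 i1 ^+ B i1 i1 * mxY d i2 i2 ^+ B i2 i2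
  * (mxY d i0 i1 * mxY d i1 i0) ^+ B i0 i1
  * (mxY d i1 i2 * mxY d i2 i1) ^+ B i1 i2
  * (mxY d i0 i2 * mxY d i2 i0) ^+ B i2 i0 * cyc' d ^+ k)).
  move=> d; rewrite /monoY !big_ord3 /= E01 E12 E20 /cyc' !exprMn !exprD.
  by ring.
by do 6![apply: (subalgM algL); last by [apply: c2 | apply: subalgX | ]].
Qed.

End Entries.

(** Only the monomials of weight zero contribute to a function that is
    invariant under the one-parameter subgroup scaling the coordinate a. *)
Lemma weight_zero (I : eqType) (s : seq I) (c : I -> G * G -> C)
    (B : I -> 'I_3 -> 'I_3 -> nat) (a : 'I_3) f : conj_invariant f ->
  (forall m d d', mxX d = mxX d' -> c m d = c m d') ->
  (forall d, is_diag_mx (mxX d) ->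
     f d = \sum_(m <- s) c m d * monoY (B m) d) ->
  forall d, is_diag_mx (mxX d) ->
    f d = \sum_(m <- s | rowdeg (B m) a == coldeg (B m) a)
            c m d * monoY (B m) d.
Proof.
move=> fi cX fE d D.
pose N := (\max_(m <- s) coldeg (B m) a)%N.
have leN m : m \in s -> (coldeg (B m) a <= N)%N.
  by move=> ms; apply: (leq_bigmax_seq (F := fun m => coldeg (B m) a)).
(* N is large enough to clear the denominators w^(coldeg) *)
pose q : {poly C} := \sum_(m <- s) (c m d * monoY (B m) d) *:
  'X^(N - coldeg (B m) a + rowdeg (B m) a) - (f d) *: 'X^N.
have q0 : q = 0.
  apply: (@poly_vanish1 C q 'X 1); first by rewrite hornerX oner_neq0.
  move=> w; rewrite hornerX => w0.
  pose t (i : 'I_3) := if i == a then w else 1.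
  have t0 i : t i != 0 by rewrite /t; case: ifP => // _; apply: oner_neq0.
  have tprod (k : 'I_3 -> nat) : \prod_i t i ^+ k i = w ^+ k a.
    rewrite (bigD1 a) //= big1 /t ?eqxx ?mulr1 // => i /negPf ->.
    by rewrite expr1n.
  have [d' [cd X' Y']] := conjugate_torus D t0.
  have monoE b : monoY b d' * w ^+ coldeg b a = w ^+ rowdeg b a * monoY b d.
    rewrite -!tprod.
    have -> : \prod_i t i ^+ rowdeg b i = \prod_i \prod_j t i ^+ b i j.
      by apply: eq_bigr => i _; rewrite /rowdeg -prodrXr.
    have -> : \prod_i t i ^+ coldeg b i = \prod_i \prod_j t j ^+ b i j.
      rewrite exchange_big; apply: eq_bigr => i _.
      by rewrite /coldeg -prodrXr.
    rewrite /monoY -!big_split /=; apply: eq_bigr => i _.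
    rewrite -!big_split /=; apply: eq_bigr => j _.
    by rewrite Y' -!exprMn; congr (_ ^+ _); field.
  have fd : f d = f d' by rewrite (invariant_conjugate fi cd).
  rewrite /q hornerD hornerN hornerZ hornerXn horner_sum.
  apply/eqP; rewrite subr_eq0 fd (fE d') ?X' // mulr_suml; apply/eqP.
  rewrite !big_seq; apply: eq_bigr => m ms.
  have wN : w ^+ N = w ^+ (N - coldeg (B m) a) * w ^+ coldeg (B m) a.
    by rewrite -exprD subnK ?leN.
  rewrite hornerZ hornerXn (cX m d' d X') wN exprD.
  apply: (lincomb1 (k := - (c m d * w ^+ (N - coldeg (B m) a))) _ (monoE (B m))).
  by ring.
(* the coefficient of X^N collects the monomials of weight zero *)
have := congr1 (fun q : {poly C} => q`_N) q0.
rewrite coef0 /q coefB coefZ coefXn eqxx mulr1 coef_sum => /eqP.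
rewrite subr_eq0 => /eqP <-; rewrite [RHS]big_mkcond /= !big_seq.
apply: eq_bigr => m ms; rewrite coefZ coefXn.
have -> : (N == N - coldeg (B m) a + rowdeg (B m) a)%N =
  (rowdeg (B m) a == coldeg (B m) a) by move: (leN m ms); lia.
by case: ifP; rewrite ?mulr1 ?mulr0.
Qed.

(** The expansion of a regular function into monomials in the entries. *)
Lemma regular_mono f : regular_function f ->
  exists (s : seq 'X_{1..(3 * 3 + 3 * 3)}) (c : _ -> C) (A B : _ -> _ -> _ -> nat),
  forall d, f d = \sum_(m <- s)
    (c m * \prod_i \prod_j mxX d i j ^+ A m i j) * monoY (B m) d.
Proof.
move=> [p pE]; exists (msupp p), (fun m => p@_m).
exists (fun m i j => m (lshift _ (mxvec_index i j))).
exists (fun m i j => m (rshift _ (mxvec_index i j))).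
move=> d; rewrite pE mevalE; apply: eq_bigr => m _; rewrite -mulrA.
congr (_ * _); rewrite big_split_ord /=.
have bij := curry_mxvec_bij 3 3.
congr (_ * _).
  rewrite (reindex _ bij) pair_bigA /=; apply: eq_bigr => -[i j] _ /=.
  by rewrite row_mxEl mxvecE.
rewrite (reindex _ bij) /monoY pair_bigA /=; apply: eq_bigr => -[i j] _ /=.
by rewrite row_mxEr mxvecE.
Qed.

(** A regular invariant function is, over the pairs with x_1 diagonal, a
    combination of products of traces and of the commutator trace, up to
    denominators. *)
Lemma locspan_regular (S : set (G * G -> C)) f : subalgebra S ->
  S (@u1 C) -> S (@u2 C) -> S (@u3 C) -> S (@u4 C) -> S (@u5 C) -> S (@u6 C) ->
  S (@tanti C) -> regular_function f -> conj_invariant f -> locspan S f.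
Proof.
move=> algS s1 s2 s3 s4 s5 s6 st /regular_mono[s [c [A [B fE]]]] fi.
have algL := locspan_subalg algS.
pose b m d := c m * \prod_i \prod_j mxX d i j ^+ A m i j.
have bX m d d' : mxX d = mxX d' -> b m d = b m d' by rewrite /b => ->.
have w0 := weight_zero i0 fi bX (fun d _ => fE d).
have w1 : forall d, is_diag_mx (mxX d) -> f d = \sum_(m <-
    [seq m <- s | rowdeg (B m) i0 == coldeg (B m) i0] |
    rowdeg (B m) i1 == coldeg (B m) i1) b m d * monoY (B m) d.
  by apply: weight_zero => // d D; rewrite big_filter w0.
apply: locspan_diag (fun d D => esym (w1 d D)) _.
apply: (@subalg_ext _ _ _ (fun d => \sum_(m <- s | (rowdeg (B m) i0 == coldeg (B m) i0)
    && (rowdeg (B m) i1 == coldeg (B m) i1)) b m d * monoY (B m) d)).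
  by move=> d; rewrite big_filter_cond.
apply: (subalg_sum algL) => m /andP[/eqP e0 /eqP e1].
apply: (subalgM algL); last exact: locspan_monoY.
apply: (subalgM algL); first exact: subalg_const.
apply: (subalg_prod algL) => i; apply: (subalg_prod algL) => j.
apply: (subalgX algL); have [->|nij] := eqVneq i j.
  exact/locspan_eigenspan/eigenspan_xs.
apply: locspan_diag (subalg_const algL 0) => d /is_diag_mxP D.
by rewrite D.
Qed.

End TorusInvariants.

(** * Removing the denominators *)

Section Generation.
Variable C : numClosedFieldType.
Local Notation G := (SL C 3).
Implicit Types (d : G * G) (f g : G * G -> C).

Let algT := trace_alg_subalg C.
Let algR := regular_subalg C.

Lemma trace_alg_invariant f : trace_alg f -> conj_invariant f.
Proof.
apply: trace_alg_min; try by [exact: t1_inv | exact: t2_inv | exact: u1_inv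
  | exact: u2_inv | exact: u3_inv | exact: u4_inv | exact: u5_inv | exact: u6_inv].
split=> [//|a g h gi hi x d|g h gi hi x d]; by rewrite gi hi.
Qed.

Lemma trace_alg_regular f : trace_alg f -> regular_function f.
Proof.
have rX := @regular_mxX C; have rY := @regular_mxY C.
have rX' := regular_adj3 rX; have rY' := regular_adj3 rY.
apply: (trace_alg_min algR).
- exact: regular_tr rX.
- exact: regular_ext (fun d => esym (t2E d)) (regular_tr rX').
- exact: regular_tr rY.
- exact: regular_tr (regular_mxM rX rY).
- exact: regular_ext (fun d => esym (u3E d)) (regular_tr (regular_mxM rX' rY)).
- exact: regular_ext (fun d => esym (u4E d)) (regular_tr rY').
- exact: regular_ext (fun d => esym (u5E d)) (regular_tr (regular_mxM rX rY')).
- exact: regular_ext (fun d => esym (u6E d)) (regular_tr (regular_mxM rX' rY')).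
Qed.

Lemma tanti_regular : regular_function (@tanti C).
Proof. exact: (subalgB algR (@tc_regular C) (@tc'_regular C)). Qed.

Lemma disc_regular : regular_function (@disc C).
Proof. exact/trace_alg_regular/trace_alg_disc. Qed.

Lemma disc_cancel2 f g : regular_function f -> regular_function g ->
  (forall d, disc d * f d = disc d * g d) -> f =1 g.
Proof.
move=> rf rg fg d; apply: subr0_eq; move: d.
apply: (disc_cancel (subalgB algR rf rg)) => d d0.
by apply: subr0_eq; rewrite subr0; apply: (mulfI d0); rewrite mulrBr fg subrr mulr0.
Qed.

Lemma trace_alg_tanti_sq : trace_alg (fun d => @tanti C d ^+ 2).
Proof.
have ti : conj_invariant (fun d => @tanti C d ^+ 2).
  by move=> g d; rewrite tanti_inv.
have rt : regular_function (fun d => @tanti C d ^+ 2).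
  exact/(subalgX algR)/tanti_regular.
have [k [a aT aE]] := locspan_invariant algT trace_alg_invariant
  (trace_alg_t1 C) (trace_alg_t2 C) ti (locspan_tanti_sq algT
  (trace_alg_u1 C) (trace_alg_u2 C) (trace_alg_u3 C)
  (trace_alg_u4 C) (trace_alg_u5 C) (trace_alg_u6 C)).
elim: k a aT aE => [|k IH] a aT aE.
  by apply: (subalg_ext (S := @trace_alg C) _ aT) => d; rewrite -aE mul1r.
have [|q qT qE] := trace_alg_dvd1 aT.
  by move=> d d0; rewrite -aE d0 exprS !mul0r.
apply: (IH q qT); apply: disc_cancel2.
- apply: (subalgM algR) rt; exact/(subalgX algR)/disc_regular.
- exact: trace_alg_regular.
- by move=> d; rewrite mulrA -exprS aE qE.
Qed.

(** The functions of the form b0 + b1 tanti with b0, b1 in the trace algebra;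
    they form an algebra because tanti^2 is in the trace algebra. *)
Definition full_alg f := exists b0 b1,
  [/\ trace_alg b0, trace_alg b1 & forall d, f d = b0 d + b1 d * @tanti C d].

Lemma full_alg_trace f : trace_alg f -> full_alg f.
Proof.
move=> fT; exists f, (fun=> 0); split=> //; first exact: subalg_const.
by move=> d; rewrite mul0r addr0.
Qed.

Lemma full_alg_tanti : full_alg (@tanti C).
Proof.
exists (fun=> 0), (fun=> 1); split; try exact: subalg_const.
by move=> d; rewrite add0r mul1r.
Qed.

Lemma full_alg_subalg : subalgebra full_alg.
Proof.
split=> [|a f g [b0 [b1 [T0 T1 fE]]] [c0 [c1 [U0 U1 gE]]]|
         f g [b0 [b1 [T0 T1 fE]]] [c0 [c1 [U0 U1 gE]]]].
- exact: (full_alg_trace (subalg_const algT 1)).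
- have ac := subalg_const algT a.
  exists (fun d => a * b0 d + c0 d), (fun d => a * b1 d + c1 d); split.
  + by apply: (subalgD algT) => //; apply: (subalgM algT).
  + by apply: (subalgD algT) => //; apply: (subalgM algT).
  + by move=> d; rewrite fE gE; ring.
- exists (fun d => b0 d * c0 d + b1 d * c1 d * tanti d ^+ 2),
    (fun d => b0 d * c1 d + b1 d * c0 d); split.
  + apply: (subalgD algT); first exact: (subalgM algT).
    by apply: (subalgM algT) trace_alg_tanti_sq; apply: (subalgM algT).
  + by apply: (subalgD algT); apply: (subalgM algT).
  + by move=> d; rewrite fE gE; ring.
Qed.

Lemma full_alg_invariant f : full_alg f -> conj_invariant f.
Proof.
move=> [b0 [b1 [T0 T1 fE]]] g d.
by rewrite !fE tanti_inv (trace_alg_invariant T0) (trace_alg_invariant T1).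
Qed.

(** On the locus disc = 0, transposition separates the two terms of an element
    of the full algebra; each of them is then divisible by disc. *)
Lemma full_alg_dvd f : full_alg f -> (forall d, disc d = 0 -> f d = 0) ->
  exists2 q, full_alg q & forall d, f d = disc d * q d.
Proof.
move=> [b0 [b1 [T0 T1 fE]]] f0; have n2 := nat_neq0 C 1.
have sep d : disc d = 0 -> b0 d = 0 /\ b1 d * tanti d = 0.
  move=> d0; have e1 : b0 d + b1 d * tanti d = 0 by rewrite -fE f0.
  have e2 : b0 d - b1 d * tanti d = 0.
    have /f0 : disc (transpose d) = 0.
      by rewrite (trace_alg_transpose (trace_alg_disc C)).
    by rewrite fE tanti_transpose !trace_alg_transpose // mulrN.
  split; apply: (mulfI n2).
    by apply: (lincomb2 (k := 1) (l := 1) _ e1 e2); ring.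
  by apply: (lincomb2 (k := 1) (l := -1) _ e1 e2); ring.
have [|q0 Q0 q0E] := trace_alg_dvd1 T0; first by move=> d /sep[].
have [||q1 Q1 q1E] := trace_alg_dvd T1 trace_alg_tanti_sq.
- move=> r r0 r3; have [d [d1 d2 td]] := tanti_slice r0 r3.
  by exists d; rewrite d1 d2 expf_neq0.
- by move=> d /sep[_ h]; rewrite expr2 mulrA h mul0r.
exists (fun d => q0 d + q1 d * tanti d); first by exists q0, q1.
by move=> d; rewrite fE q0E q1E; ring.
Qed.

Lemma full_alg_regular f : full_alg f -> regular_function f.
Proof.
move=> [b0 [b1 [T0 T1 fE]]]; apply: regular_ext (fun d => esym (fE d)) _.
apply: (subalgD algR); first exact: trace_alg_regular.
by apply: (subalgM algR); [exact: trace_alg_regular | exact: tanti_regular].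
Qed.

Lemma invariant_full_alg f : regular_function f -> conj_invariant f ->
  full_alg f.
Proof.
move=> rf fi; have inT := full_alg_trace.
have [k [a aT aE]] := locspan_invariant full_alg_subalg full_alg_invariant
  (inT _ (trace_alg_t1 C)) (inT _ (trace_alg_t2 C)) fi
  (locspan_regular full_alg_subalg (inT _ (trace_alg_u1 C))
  (inT _ (trace_alg_u2 C)) (inT _ (trace_alg_u3 C)) (inT _ (trace_alg_u4 C))
  (inT _ (trace_alg_u5 C)) (inT _ (trace_alg_u6 C)) full_alg_tanti rf fi).
elim: k a aT aE => [|k IH] a aT aE.
  by apply: (subalg_ext (S := full_alg) _ aT) => d; rewrite -aE mul1r.
have [|q qT qE] := full_alg_dvd aT.
  by move=> d d0; rewrite -aE d0 exprS !mul0r.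
apply: (IH q qT); apply: disc_cancel2.
- apply: (subalgM algR) rf; exact/(subalgX algR)/disc_regular.
- exact: full_alg_regular.
- by move=> d; rewrite mulrA -exprS aE qE.
Qed.

(** The trace of the commutator plus that of its inverse is invariant under
    transposition, so that its tanti component vanishes. *)
Lemma trace_alg_tc_sum : trace_alg (fun d => @tc C d + tc' d).
Proof.
have [||b0 [b1 [T0 T1 E]]] := @invariant_full_alg (fun d => @tc C d + tc' d).
- exact: (subalgD algR (@tc_regular C) (@tc'_regular C)).
- by move=> g d; rewrite tc_inv tc'_inv.
have n2 := nat_neq0 C 1.
apply: (subalg_ext (S := @trace_alg C) _ T0) => d; have e1 := E d; have := E (transpose d).
rewrite tc_transpose tc'_transpose tanti_transpose !trace_alg_transpose // => e2.
apply: (mulfI n2).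
by apply: (lincomb2 (k := - 1) (l := -1) _ e1 e2); ring.
Qed.

End Generation.

Theorem lemma3p1p1 (R : realType) :
  invariant_ring R[i] 3 =
  smallest (@subalgebra (SL R[i] 3 * SL R[i] 3)%type R[i])
    [set word_trace (fun x1 x2 => x1);
         word_trace (fun x1 x2 => x2);
         word_trace (fun x1 x2 => x1 * x2)%g;
         word_trace (fun x1 x2 => x1 * x2^-1)%g;
         word_trace (fun x1 x2 => x1^-1)%g;
         word_trace (fun x1 x2 => x2^-1)%g;
         word_trace (fun x1 x2 => x1^-1 * x2^-1)%g;
         word_trace (fun x1 x2 => x1^-1 * x2)%g;
         word_trace (fun x1 x2 => x1 * x2 * x1^-1 * x2^-1)%g].
Proof.
pose C : numClosedFieldType := R[i].
apply/seteqP; split=> f.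
  move=> [rf fi] A [algA genA].
  have gA : forall g, _ -> A g := genA.
  have a1 : A (@t1 C) by apply: gA; do 8?left.
  have a2 : A (@t2 C) by apply: gA; do 4?left; right.
  have b1 : A (@u1 C) by apply: gA; do 7?left; right.
  have b2 : A (@u2 C) by apply: gA; do 6?left; right.
  have b3 : A (@u3 C) by apply: gA; do 1?left; right.
  have b4 : A (@u4 C) by apply: gA; do 3?left; right.
  have b5 : A (@u5 C) by apply: gA; do 5?left; right.
  have b6 : A (@u6 C) by apply: gA; do 2?left; right.
  have ac : A (@tc C) by apply: gA; right.
  have inA := trace_alg_min algA a1 a2 b1 b2 b3 b4 b5 b6.
  have at_ : A (@tanti C).
    apply: subalg_ext (subalgB algA (subalgM algA (subalg_const algA 2%:R) ac)
      (inA _ (trace_alg_tc_sum C))) => d.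
    by rewrite /tanti; ring.
  have [b0 [b1' [T0 T1 fE]]] := invariant_full_alg rf fi.
  apply: subalg_ext (fun d => esym (fE d)) _.
  by apply: (subalgD algA); [exact: inA | apply: (subalgM algA) => //; exact: inA].
move=> /(_ (invariant_ring R[i] 3)); apply; split.
  have [R1 RL RM] := regular_subalg C.
  split=> [|a g h [rg gi] [rh hi]|g h [rg gi] [rh hi]]; split=> //.
  - exact: RL.
  - by move=> x d; rewrite gi hi.
  - exact: RM.
  - by move=> x d; rewrite gi hi.
have T g : trace_alg g -> invariant_ring R[i] 3 g.
  by move=> gT; split; [exact: (@trace_alg_regular C) | exact: (@trace_alg_invariant C)].
move=> g [[[[[[[[->|->]|->]|->]|->]|->]|->]|->]|->].
- exact/T/(trace_alg_t1 C).
- exact/T/(trace_alg_u1 C).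
- exact/T/(trace_alg_u2 C).
- exact/T/(trace_alg_u5 C).
- exact/T/(trace_alg_t2 C).
- exact/T/(trace_alg_u4 C).
- exact/T/(trace_alg_u6 C).
- exact/T/(trace_alg_u3 C).
- by split; [exact: (@tc_regular C) | exact: (@tc_inv C)].
Qed.
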